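(* Let $p\ge 3$, let $a$ satisfy $p/2+a+1>0$, and let $L:[1,\infty)\to[0,\infty)$ satisfy (L1)–(L3) (given in the context). Let $Z\sim N_p(\mu,I_p)$ and consider estimation of $\mu$ under quadratic loss $\|\hat\mu-\mu\|^2$, with the prior density $\pi(\mu)=G(\|\mu\|;a,L)$. (1) Suppose $a=-2$ and, for some $b>1$, $\{\log(y)\}^b/L(y)$ is ultimately monotone non-increasing. Then the generalized Bayes estimator with respect to $\pi$ is inadmissible. (2) Suppose $a<-2$. Then the generalized Bayes estimator with respect to $\pi$ is inadmissible.
   Context: The prior is $$G(\|\mu\|;a,L)=\int_0^1\Big\{\frac{\lambda}{1-\lambda}\Big\}^{p/2}\exp\Big(-\frac{\lambda}{1-\lambda}\frac{\|\mu\|^2}{2}\Big)\lambda^aL(1/\lambda)\,d\lambda .$$ Assumptions on $L$: (L1) $L$ is slowly varying at infinity: $\lim_{y\to\infty}L(cy)/L(y)=1$ for all $c>0$; (L2) $L$ is ultimately monotone; (L3) $L$ is differentiable with ultimately monotone derivative $L'$. ''Ultimately'' means on $[y_0,\infty)$ for some $y_0$. The generalized Bayes estimator is the posterior mean of $\mu$ given $Z$ (the prior may be improper). An estimator is inadmissible if some other estimator has risk (expected loss) no larger for all $\mu$ and strictly smaller for some $\mu$. *)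

(* Defs.v *)
From HB Require Import structures.
From mathcomp Require Import all_boot all_order all_algebra.
From mathcomp Require Import all_classical all_reals all_analysis.
Set Implicit Arguments.
Unset Strict Implicit.
Unset Printing Implicit Defensive.
Import Order.TTheory GRing.Theory Num.Theory.
Import numFieldNormedType.Exports.

Local Open Scope classical_set_scope.
Local Open Scope ring_scope.

(* R^p, with the sigma-algebra generated by the coordinates. *)
Notation vec R p := (p.-tuple (measurableTypeR R)).

Definition vcons (R : realType) (p : nat)
    (x : measurableTypeR R * vec R p) : vec R p.+1 :=
  [the p.+1.-tuple (measurableTypeR R) of x.1 :: x.2].

Fixpoint lebesgue_vec (R : realType) (p : nat) : set (vec R p) -> \bar R :=
  match p return set (vec R p) -> \bar R with
  | 0 => dirac (nil_tuple (measurableTypeR R))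
  | q.+1 => pushforward (@lebesgue_measure R \x @lebesgue_vec R q)%E
              (@vcons R q)
  end.

Lemma measurable_vcons (R : realType) (p : nat) :
  measurable_fun [set: measurableTypeR R * vec R p] (@vcons R p).
Proof. exact: measurable_cons. Qed.

Lemma measurable_vcons_inv (R : realType) (p : nat) :
  measurable_fun [set: vec R p.+1]
    (fun t : vec R p.+1 => (thead t, [tuple of behead t])).
Proof.
apply/measurable_fun_pairP; split => /=; first exact: measurable_tnth.
exact: measurable_behead.
Qed.

Lemma sigma_finite_measure_pack (d : measure_display) (T : measurableType d)
    (R : realType) (f : set T -> \bar R) :
  f set0 = 0%E -> (forall A, 0 <= f A)%E -> semi_sigma_additive f ->
  sigma_finite [set: T] f ->
  exists m : {sigma_finite_measure set T -> \bar R}, f = m.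
Proof.
move=> f0 f_ge0 fsa sff.
pose H0 := isMeasure.Build _ _ _ f f0 f_ge0 fsa.
pose m0 : {measure set T -> \bar R} := HB.pack f H0.
pose H1 := Measure_isSigmaFinite.Build _ _ _ m0 sff.
pose m : {sigma_finite_measure set T -> \bar R} := HB.pack f H0 H1.
by exists m.
Qed.

Lemma lebesgue_vec_sigma_finite_measure (R : realType) (p : nat) :
  exists m : {sigma_finite_measure set (vec R p) -> \bar R},
    @lebesgue_vec R p = m.
Proof.
elim: p => [|p [m mE]].
  by exists (dirac (nil_tuple (measurableTypeR R))).
pose L : {measure set (measurableTypeR R * vec R p)%type -> \bar R} :=
  (@lebesgue_measure R \x m)%E.
pose g (t : vec R p.+1) : measurableTypeR R * vec R p :=
  (thead t, [tuple of behead t]).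
have gK x : g (vcons x) = x.
  by case: x => x t; rewrite /g theadE; congr pair; exact/val_inj.
have sfL : sigma_finite [set: vec R p.+1] (pushforward L (@vcons R p)).
  have /sigma_finiteP[F [FT ndF Foo]] := sigma_finiteT (@lebesgue_measure R).
  have /sigma_finiteP[H [HT ndH Hoo]] := sigma_finiteT m.
  exists (fun n => g @^-1` (F n `*` H n)).
    rewrite -preimage_bigcup (_ : \bigcup_n _ = setT) ?preimage_setT//.
    rewrite -subTset => -[x y] _.
    have [n _ Fnx] : (\bigcup_n F n) x by rewrite -FT.
    have [k _ Hky] : (\bigcup_n H n) y by rewrite -HT.
    exists (maxn n k) => //; split => /=.
    - by move: x Fnx; exact/subsetPset/ndF/leq_maxl.
    - by move: y Hky; exact/subsetPset/ndH/leq_maxr.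
  move=> n; have [mF Fn] := Foo n; have [mH Hn] := Hoo n; split.
    rewrite -[X in measurable X]setTI; apply: measurable_vcons_inv => //.
    exact: measurableX.
  rewrite /pushforward (_ : _ @^-1` _ = F n `*` H n); last first.
    by apply/seteqP; split => x; rewrite /preimage /mkset gK.
  rewrite [ltLHS](product_measure1E _ _ mF mH).
  by rewrite lte_mul_pinfty// ge0_fin_numE.
pose P : {measure set (vec R p.+1) -> \bar R} :=
  measure_function_pushforward__canonical__measure_function_Measure L (@measurable_vcons R p).
have [m' m'E] := sigma_finite_measure_pack (measure0 P)
  (measure_ge0 P) (@measure_semi_sigma_additive _ _ _ P) sfL.
by exists m'; rewrite -m'E /= mE.
Qed.

Lemma lebesgue_vec0 (R : realType) (p : nat) : @lebesgue_vec R p set0 = 0%E.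
Proof.
by have [m ->] := lebesgue_vec_sigma_finite_measure R p; rewrite measure0.
Qed.

Lemma lebesgue_vec_ge0 (R : realType) (p : nat) (A : set (vec R p)) :
  (0 <= lebesgue_vec A)%E.
Proof. by have [m ->] := lebesgue_vec_sigma_finite_measure R p. Qed.

Lemma lebesgue_vec_semi_sigma_additive (R : realType) (p : nat) :
  semi_sigma_additive (@lebesgue_vec R p).
Proof.
have [m ->] := lebesgue_vec_sigma_finite_measure R p.
exact: measure_semi_sigma_additive.
Qed.

Lemma lebesgue_vec_sigma_finite (R : realType) (p : nat) :
  sigma_finite [set: vec R p] (@lebesgue_vec R p).
Proof.
by have [m ->] := lebesgue_vec_sigma_finite_measure R p; exact: sigma_finiteT.
Qed.

HB.instance Definition _ (R : realType) (p : nat) :=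
  isMeasure.Build _ _ _ (@lebesgue_vec R p) (@lebesgue_vec0 R p)
    (@lebesgue_vec_ge0 R p) (@lebesgue_vec_semi_sigma_additive R p).

HB.instance Definition _ (R : realType) (p : nat) :=
  Measure_isSigmaFinite.Build _ _ _ (@lebesgue_vec R p)
    (@lebesgue_vec_sigma_finite R p).

Definition sqnorm (R : realType) (p : nat) (x : vec R p) : R :=
  \sum_(i < p) tnth x i ^+ 2.

Definition enorm (R : realType) (p : nat) (x : vec R p) : R :=
  Num.sqrt (sqnorm x).

Definition vsub (R : realType) (p : nat) (x y : vec R p) : vec R p :=
  [tuple (tnth x i : R) - tnth y i | i < p].

(* Density at z of N_p(mu, I_p). *)
Definition std_normal_density (R : realType) (p : nat) (mu z : vec R p) : R :=
  (2 * pi) `^ (- (p%:R / 2)) * expR (- (sqnorm (vsub z mu) / 2)).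

(* Expected quadratic loss of the estimator delta at mu, for Z ~ N_p(mu, I_p). *)
Definition risk (R : realType) (p : nat) (delta : vec R p -> vec R p)
    (mu : vec R p) : \bar R :=
  (\int[@lebesgue_vec R p]_z
     (sqnorm (vsub (delta z) mu) * std_normal_density mu z)%:E)%E.

Definition inadmissible (R : realType) (p : nat)
    (delta : vec R p -> vec R p) : Prop :=
  exists delta' : vec R p -> vec R p,
    [/\ measurable_fun [set: vec R p] delta',
        forall mu, (risk delta' mu <= risk delta mu)%E
      & exists mu, (risk delta' mu < risk delta mu)%E].

Definition marginal (R : realType) (p : nat) (prior : vec R p -> \bar R)
    (z : vec R p) : \bar R :=
  (\int[@lebesgue_vec R p]_mu ((std_normal_density mu z)%:E * prior mu))%E.

(* Posterior mean of mu given Z = z; [fine] is harmless whenever the marginal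
   and the first posterior moments are finite. *)
Definition gen_bayes (R : realType) (p : nat) (prior : vec R p -> \bar R)
    (z : vec R p) : vec R p :=
  [tuple fine (\int[@lebesgue_vec R p]_mu
                 ((tnth mu i * std_normal_density mu z)%:E * prior mu))%E
         / fine (marginal prior z) | i < p].

(* Extended-real valued since the integral can diverge at r = 0. *)
Definition G (R : realType) (p : nat) (a : R) (L : R -> R) (r : R) : \bar R :=
  (\int[@lebesgue_measure R]_(l in `]0%R, 1%R[)
     ((l / (1 - l)) `^ (p%:R / 2) * expR (- (l / (1 - l) * (r ^+ 2 / 2)))
      * l `^ a * L l^-1)%:E)%E.

Definition prior_density (R : realType) (p : nat) (a : R) (L : R -> R)
    (mu : vec R p) : \bar R :=
  G p a L (enorm mu).

(* Where L y = 0 the quotient is 0, so the limit forces L y != 0 for large y. *)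
Definition slowly_varying (R : realType) (L : R -> R) : Prop :=
  forall c : R, 0 < c -> L (c * y) / L y @[y --> +oo] --> (1 : R).

(* y0 may always be enlarged, so values of f outside the domain of interest
   [1, +oo[ play no role. *)
Definition ultimately_nondecreasing (R : realType) (f : R -> R) : Prop :=
  exists y0 : R, {in `[y0, +oo[ &, {homo f : x y / x <= y}}.

Definition ultimately_nonincreasing (R : realType) (f : R -> R) : Prop :=
  exists y0 : R, {in `[y0, +oo[ &, {homo f : x y /~ x <= y}}.

Definition ultimately_monotone (R : realType) (f : R -> R) : Prop :=
  ultimately_nondecreasing f \/ ultimately_nonincreasing f.

(* Differentiability on [a, +oo[, one-sided at a. *)
Definition differentiable_from (R : realType) (a : R) (f : R -> R) : Prop :=
  (forall x, a < x -> derivable f x 1) /\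
  cvg (h^-1 * (f (a + h) - f a) @[h --> 0^'+]).

(* Main.v *)
Require Import Defs.
From HB Require Import structures.
From mathcomp Require Import all_boot all_order all_algebra.
From mathcomp Require Import all_classical all_reals all_analysis.
From mathcomp Require Import measurable_realfun ring lra.
Set Implicit Arguments.
Unset Strict Implicit.
Unset Printing Implicit Defensive.
Import Order.TTheory GRing.Theory Num.Theory.
Import numFieldNormedType.Exports.

Local Open Scope classical_set_scope.
Local Open Scope ring_scope.

(** The generalized Bayes estimators in question shrink the observation [z]
    towards the origin a little too weakly when [z] is large; shrinking slightly
    more there lowers the risk everywhere.

    For fixed [l], the integrand defining the prior is proportional in [mu] to
    the density of N(0, ((1 - l) / l) I), so that the prior is a scale mixture
    of normal laws. Completing the square turns the conditional posterior given
    [l] into N((1 - l) z, (1 - l) I), and Tonelli's theorem gives the posterior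
    mean [(1 - k w) z], where [w] is the squared norm of [z] and [k w] is the
    mean of [l] under the weight [W l * expR (- (l * w / 2))], with
    [W l = l `^ (p / 2 + a) * L l^-1] on ]0, 1[ (lemmas [prior_density_mixture]
    and [gen_bayes_mixture]). Thus [k w = J1 / J0] is a quotient of two Laplace
    transforms.

    For the pure power weight [l `^ (q - 1)], [q = p / 2 + a + 1], on the whole
    half-line, [w * k w] is exactly [2 * q], which is [p - 2 + 2 * (a + 2)]. So
    for [a < - 2] the value [w * k w] stays away from [p - 2], from below, since
    a slowly varying [L] is beaten by any power. For [a = - 2] the limit is
    [p - 2], and the growth of [L], at least that of a power [b > 1] of the
    logarithm, gives weight to the small values of [l] and lowers [w * k w] to
    about [p - 2 - 2 * b / ln w]. In both cases there is some [bp > 1] such that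
    eventually [w * k w <= p - 2 - 2 * bp / ln w] (lemmas [mixing_deficit_lt]
    and [mixing_deficit_log], both through [laplace_ratio_deficit]). The
    inequality is obtained by comparing [W] with a power weight on the range of
    [l] that matters, above [w `^ (- (1 + eta))] (lemma [laplace_ratio_ge]).

    If [k] is replaced by [k + u], Stein's identity (lemma
    [integral_stein_term]) shows that the risk changes by the expectation of
    [w * u ^+ 2 + 2 * u * (w * k) - 2 * (p * u + 2 * w * u')]. Take [u] to be zero
    up to some [w0] and close to [c / (w * ln w)] at infinity. The terms of order
    [u] cancel down to the deficit of [w * k w] below [p - 2], and what remains
    is at most about [u / ln w * (c + 4 - 4 * bp)], which is negative when
    [c = 2 * (bp - 1)] (lemmas [extra_gain] and [risk_extra]). *)

(** * Iterated integration over R^p *)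

Lemma ge0_integral_pushforward_prod d1 d2 d3 (T1 : measurableType d1)
    (T2 : measurableType d2) (T3 : measurableType d3) (R : realType)
    (m1 : {sigma_finite_measure set T1 -> \bar R})
    (m2 : {sigma_finite_measure set T2 -> \bar R})
    (phi : T1 * T2 -> T3) (f : T3 -> \bar R) :
  measurable_fun [set: T1 * T2] phi -> measurable_fun [set: T3] f ->
  (forall z, 0 <= f z)%E ->
  (\int[pushforward (m1 \x m2) phi]_z f z =
   \int[m1]_x \int[m2]_y f (phi (x, y)))%E.
Proof.
move=> mphi mf f0.
rewrite ge0_integral_pushforward // preimage_setT.
rewrite fubini_tonelli1 //.
  exact: measurableT_comp.
by move=> x; exact: f0.
Qed.

Lemma integral_pushforward_prod d1 d2 d3 (T1 : measurableType d1)
    (T2 : measurableType d2) (T3 : measurableType d3) (R : realType)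
    (m1 : {sigma_finite_measure set T1 -> \bar R})
    (m2 : {sigma_finite_measure set T2 -> \bar R})
    (phi : T1 * T2 -> T3) (f : T3 -> \bar R) :
  measurable_fun [set: T1 * T2] phi -> measurable_fun [set: T3] f ->
  (\int[pushforward (m1 \x m2) phi]_z `|f z| < +oo)%E ->
  (\int[pushforward (m1 \x m2) phi]_z f z =
   \int[m1]_x \int[m2]_y f (phi (x, y)))%E /\
  (\int[pushforward (m1 \x m2) phi]_z f z =
   \int[m2]_y \int[m1]_x f (phi (x, y)))%E.
Proof.
move=> mphi mf foo.
have ifphi : (m1 \x m2)%E.-integrable [set: T1 * T2] (f \o phi).
  apply/integrableP; split; first exact: measurableT_comp.
  rewrite ge0_integral_pushforward // in foo.
  exact: measurableT_comp.
rewrite integral_pushforward // preimage_setT.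
split; first by rewrite -integral12_prod_meas1.
by rewrite -integral21_prod_meas1.
Qed.

Lemma lebesgue_vecS (R : realType) (p : nat) :
  @lebesgue_vec R p.+1 =
  pushforward (@lebesgue_measure R \x @lebesgue_vec R p)%E (@vcons R p).
Proof. by []. Qed.

Lemma ge0_integral_vecS (R : realType) (p : nat) (f : vec R p.+1 -> \bar R) :
  measurable_fun [set: vec R p.+1] f -> (forall z, 0 <= f z)%E ->
  (\int[@lebesgue_vec R p.+1]_z f z =
   \int[@lebesgue_measure R]_x \int[@lebesgue_vec R p]_t f (vcons (x, t)))%E.
Proof.
move=> mf f0; rewrite lebesgue_vecS.
by rewrite ge0_integral_pushforward_prod //; exact: measurable_vcons.
Qed.

Lemma integral_vecS (R : realType) (p : nat) (f : vec R p.+1 -> \bar R) :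
  measurable_fun [set: vec R p.+1] f ->
  (\int[@lebesgue_vec R p.+1]_z `|f z| < +oo)%E ->
  (\int[@lebesgue_vec R p.+1]_z f z =
   \int[@lebesgue_measure R]_x \int[@lebesgue_vec R p]_t f (vcons (x, t)))%E /\
  (\int[@lebesgue_vec R p.+1]_z f z =
   \int[@lebesgue_vec R p]_t \int[@lebesgue_measure R]_x f (vcons (x, t)))%E.
Proof.
rewrite lebesgue_vecS => mf foo.
by apply: integral_pushforward_prod => //; exact: measurable_vcons.
Qed.

Lemma tnth_vcons0 (R : realType) (p : nat) x (t : vec R p) :
  tnth (vcons (x, t)) ord0 = x.
Proof. by []. Qed.

Lemma tnth_vconsS (R : realType) (p : nat) x (t : vec R p) (i : 'I_p) :
  tnth (vcons (x, t)) (lift ord0 i) = tnth t i.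
Proof. exact: tnthS. Qed.

Lemma measurable_prod_tnth (R : realType) (p : nat) (f : 'I_p -> R -> R) :
  (forall i, measurable_fun [set: R] (f i)) ->
  measurable_fun [set: vec R p] (fun z => \prod_(i < p) f i (tnth z i)).
Proof.
move=> mf; apply: measurable_prod => i _.
apply: (measurableT_comp (mf i)); exact: measurable_tnth.
Qed.

Lemma ge0_integral_vec_prod (R : realType) (p : nat) (f : 'I_p -> R -> R)
    (c : 'I_p -> R) :
  (forall i, measurable_fun [set: R] (f i)) -> (forall i x, 0 <= f i x) ->
  (forall i, \int[@lebesgue_measure R]_x (f i x)%:E = (c i)%:E)%E ->
  (\int[@lebesgue_vec R p]_z (\prod_(i < p) f i (tnth z i))%:E =
   (\prod_(i < p) c i)%:E)%E.
Proof.
elim: p f c => [|p IH] f c mf f0 fc.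
  rewrite /= big_ord0.
  under eq_integral do rewrite big_ord0.
  by rewrite integral_dirac // diracT mul1e.
rewrite ge0_integral_vecS; last 2 first.
- by apply/measurable_EFinP; exact: measurable_prod_tnth.
- by move=> z; rewrite lee_fin; apply: prodr_ge0.
transitivity (\int[@lebesgue_measure R]_x
    ((f ord0 x)%:E * (\prod_(i < p) c (lift ord0 i))%:E))%E.
  apply: eq_integral => x _.
  under eq_integral => t _.
    rewrite big_ord_recl tnth_vcons0 EFinM.
    under eq_bigr do rewrite tnth_vconsS.
    over.
  rewrite ge0_integralZl_EFin //; last 2 first.
  - by move=> t _; rewrite lee_fin; apply: prodr_ge0 => i _.
  - apply/measurable_EFinP.
    by apply: (@measurable_prod_tnth R p (fun i => f (lift ord0 i))).
  by rewrite (IH (fun i => f (lift ord0 i)) (fun i => c (lift ord0 i))).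
have c0 i : 0 <= c i.
  by rewrite -lee_fin -fc; apply: integral_ge0 => x _; rewrite lee_fin.
rewrite ge0_integralZr //.
- by rewrite fc big_ord_recl EFinM.
- by apply/measurable_EFinP; exact: mf.
- by move=> x _; rewrite lee_fin.
- by rewrite lee_fin; apply: prodr_ge0.
Qed.

Definition vset (R : realType) (p : nat) (z : vec R p) (i : 'I_p) (x : R) :
  vec R p := [tuple if j == i then x else tnth z j | j < p].

Lemma vset_vcons0 (R : realType) (p : nat) y (t : vec R p) x :
  vset (vcons (y, t)) ord0 x = vcons (x, t).
Proof.
apply: eq_from_tnth => j; rewrite tnth_mktuple.
case: (unliftP ord0 j) => [k|] -> //.
by rewrite !tnth_vconsS.
Qed.

Lemma vset_vconsS (R : realType) (p : nat) y (t : vec R p) i x :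
  vset (vcons (y, t)) (lift ord0 i) x = vcons (y, vset t i x).
Proof.
apply: eq_from_tnth => j; rewrite tnth_mktuple.
case: (unliftP ord0 j) => [k|] -> //.
by rewrite !tnth_vconsS tnth_mktuple (inj_eq lift_inj).
Qed.

(** Fubini's theorem isolates the coordinate [i]. The product bound is what an
    induction on the dimension can carry along: fixing the first coordinate
    multiplies one of the remaining factors by a constant. *)
Lemma integral_vec_section0 (R : realType) (p : nat) (i : 'I_p)
    (F : vec R p -> R) (k : 'I_p -> R -> R) (c : 'I_p -> R) :
  measurable_fun [set: vec R p] F ->
  (forall j, measurable_fun [set: R] (k j)) -> (forall j x, 0 <= k j x) ->
  (forall j, \int[@lebesgue_measure R]_x (k j x)%:E = (c j)%:E)%E ->
  (forall z, `|F z| <= \prod_(j < p) k j (tnth z j)) ->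
  (forall z, \int[@lebesgue_measure R]_x (F (vset z i x))%:E = 0)%E ->
  (\int[@lebesgue_vec R p]_z (F z)%:E = 0)%E.
Proof.
elim: p i F k c => [|p IH] i F k c mF mk k0 kc Fk F0; first by case: i F0.
have [||E1 E2] := @integral_vecS R p (EFin \o F).
- exact/measurable_EFinP.
- rewrite (@le_lt_trans _ _
    (\int[@lebesgue_vec R p.+1]_z (\prod_(j < p.+1) k j (tnth z j))%:E)%E) //.
    apply: ge0_le_integral => //.
    + by apply/measurable_EFinP; apply: measurableT_comp.
    + by apply/measurable_EFinP; exact: measurable_prod_tnth.
    + by move=> z _; rewrite lee_fin.
  by rewrite (ge0_integral_vec_prod mk k0 kc) ltry.
(* If [i] is the first coordinate, it is integrated innermost. *)
move: F0; case: (unliftP ord0 i) => [i'|] -> F0; last first.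
  rewrite [LHS]E2; apply: integral0_eq => t _ /=.
  by under eq_integral do rewrite -(vset_vcons0 0).
rewrite [LHS]E1; apply: integral0_eq => y _ /=.
(* The value of the bound at the fixed first coordinate is put into the factor
   with index [i'], which exists in the case at hand. *)
apply: (IH i' _ (fun j x => if j == i' then k ord0 y * k (lift ord0 j) x
                  else k (lift ord0 j) x)
          (fun j => if j == i' then k ord0 y * c (lift ord0 j)
                  else c (lift ord0 j))) => /=.
- apply: (measurableT_comp mF).
  by apply: measurable_cons; [exact: measurable_cst|exact: measurable_id].
- by move=> j; case: (j == i'); last exact: mk; apply: measurable_funM => //; exact: mk.
- by move=> j x; case: ifP => _ //; apply: mulr_ge0.
- move=> j; case: (j == i'); last exact: kc.
  under eq_integral do rewrite EFinM.
  rewrite ge0_integralZl_EFin // ?kc ?EFinM //.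
  + by move=> x _; rewrite lee_fin.
  + by apply/measurable_EFinP; exact: mk.
- move=> t; apply: (le_trans (Fk _)).
  have -> : \prod_(j < p.+1) k j (tnth (vcons (y, t)) j) =
      k ord0 y * \prod_(j < p) k (lift ord0 j) (tnth t j).
    rewrite big_ord_recl; congr (_ * _).
    by apply: eq_bigr => j _; rewrite tnth_vconsS.
  rewrite (bigD1 i') //= [leRHS](bigD1 i') //= eqxx mulrA.
  rewrite [X in _ <= _ * X](eq_bigr (fun j => k (lift ord0 j) (tnth t j))) //.
  by move=> j /negbTE ->.
- by move=> t; under eq_integral do rewrite -vset_vconsS; exact: F0.
Qed.

(** * Stein's identity in one dimension *)

(** The integral over the line is the limit of the increments of [F] over
    intervals centred at [a]; a bound of order [1 / n] at their endpoints makes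
    these increments vanish. *)
Lemma integral_derive_eq0 (R : realType) (F f : R -> R) (a K : R) :
  (forall x : R, is_derive x 1 F (f x)) -> continuous f ->
  (@lebesgue_measure R).-integrable [set: R] (EFin \o f) ->
  (forall n : nat, `|F (a + n.+1%:R)| <= K / n.+1%:R) ->
  (forall n : nat, `|F (a - n.+1%:R)| <= K / n.+1%:R) ->
  (\int[@lebesgue_measure R]_x (f x)%:E = 0)%E.
Proof.
move=> dF cf intf Fr Fl.
pose D n : set R := `[a - n.+1%:R, a + n.+1%:R]%classic.
have mf : measurable_fun [set: R] f by exact: continuous_measurable_fun.
have mD n : measurable (D n) by exact: measurable_itv.
have cvgD : (\int[@lebesgue_measure R]_x ((EFin \o f) \_ (D n)) x @[n --> \oo]
    --> \int[@lebesgue_measure R]_x (EFin \o f) x)%E.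
  have [|||||_ _ H] := @dominated_convergence _ _ _ (@lebesgue_measure R)
      setT measurableT (fun n => (EFin \o f) \_ (D n)) (EFin \o f)
      (abse \o (EFin \o f)).
  - move=> n; apply/(measurable_restrictT _ _).1; first exact: mD.
    by apply/measurable_EFinP; exact: measurable_funTS.
  - exact/measurable_EFinP.
  - apply: aeW => x _; apply: cvg_near_cst.
    exists (Num.trunc `|x - a|) => // n /= nx.
    rewrite patchE mem_set //= /D /= in_itv /=.
    have : `|x - a| <= n.+1%:R.
      apply: (le_trans (ltW (truncnS_gt _))).
      by rewrite ler_nat.
    by rewrite ler_norml => /andP[? ?]; apply/andP; split; lra.
  - exact: integrable_abse.
  - apply: aeW => x n _; rewrite patchE; case: ifP => //= _.
    by rewrite normr0 lee_fin.
  - exact: H.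
have DE n : (\int[@lebesgue_measure R]_x ((EFin \o f) \_ (D n)) x =
    (F (a + n.+1%:R))%:E - (F (a - n.+1%:R))%:E)%E.
  have dFx (x : R) : derivable F x 1 by have [] := dF x.
  have cF : continuous F.
    by move=> x; apply/differentiable_continuous/derivable1_diffP.
  rewrite -integral_mkcond (@continuous_FTC2 _ f F) //.
  - by rewrite ltrD2l gtrN.
  - exact: continuous_subspaceT.
  - split; [by move=> x _; exact: dFx|apply: cvg_at_right_filter; exact: cF|
      apply: cvg_at_left_filter; exact: cF].
  - by move=> x _; rewrite derive1E; have [_ ->] := dF x.
have : (\int[@lebesgue_measure R]_x ((EFin \o f) \_ (D n)) x @[n --> \oo]
    --> (0 : R)%:E)%E.
  under eq_cvg do rewrite DE -EFinB.
  apply/cvg_EFin; first by near=> n.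
  apply/cvgr0Pnorm_le => e e0; rewrite /=.
  near=> n.
  rewrite (le_trans (ler_normB _ _)) // (le_trans (lerD (Fr n) (Fl n))) //.
  rewrite -mulrDl ler_pdivrMr // mulrC -ler_pdivrMr //.
  apply: (@le_trans _ _ n%:R); last by rewrite ler_nat.
  by near: n; exact: nbhs_infty_ger.
by move/(cvg_unique _ cvgD); apply.
Unshelve. all: by end_near. Qed.

(** Without the normalizing constant, so that the derivative and the products
    over coordinates stay simple. *)
Definition gauss1 (R : realType) (m v x : R) : R :=
  expR (- ((x - m) ^+ 2 / (2 * v))).

Lemma is_derive_gauss1 (R : realType) (m v x : R) : v != 0 ->
  is_derive x 1 (gauss1 m v) (- ((x - m) / v) * gauss1 m v x).
Proof.
move=> v0; rewrite mulrC /gauss1.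
apply: (@is_derive1_comp _ expR (fun x => - ((x - m) ^+ 2 / (2 * v)))).
by apply: is_derive_eq; rewrite /GRing.scale /=; field.
Qed.

Lemma continuous_gauss1 (R : realType) (m v : R) : v != 0 ->
  continuous (gauss1 m v).
Proof.
move=> v0 x; apply/differentiable_continuous/derivable1_diffP.
by have [] := is_derive_gauss1 m x v0.
Qed.

Lemma measurable_gauss1 (R : realType) (m v : R) : v != 0 ->
  measurable_fun [set: R] (gauss1 m v).
Proof. by move=> v0; apply: continuous_measurable_fun; exact: continuous_gauss1. Qed.

Lemma gauss1_ge0 (R : realType) (m v x : R) : 0 <= gauss1 m v x.
Proof. exact: expR_ge0. Qed.

Lemma integral_gauss1 (R : realType) (m v : R) : 0 < v ->
  (\int[@lebesgue_measure R]_x (gauss1 m v x)%:E = (Num.sqrt (2 * pi * v))%:E)%E.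
Proof.
move=> v0; have s0 : Num.sqrt v != 0 by rewrite gt_eqF // sqrtr_gt0.
have pk : (normal_peak (Num.sqrt v))^-1 = Num.sqrt (2 * pi * v).
  rewrite /normal_peak invrK sqr_sqrtr ?ltW //; congr Num.sqrt.
  by rewrite -mulr_natl; ring.
rewrite -pk -[RHS]mule1 -(integral_normal_pdf m (Num.sqrt v)).
rewrite -ge0_integralZl_EFin //.
- apply: eq_integral => x _; rewrite normal_pdfE // -EFinM; congr EFin.
  rewrite mulrA mulVf ?mul1r ?gt_eqF ?normal_peak_gt0 //.
  rewrite /gauss1 /normal_fun sqr_sqrtr ?ltW // mulNr; congr (expR (- (_ / _))).
  by rewrite mulr_natl.
- by move=> x _; rewrite lee_fin normal_pdf_ge0.
- by apply/measurable_EFinP; exact: measurable_normal_pdf.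
- by rewrite invr_ge0 normal_peak_ge0.
Qed.

(** Doubling the variance pays for a quadratic factor, because
    [1 + 4 * v * y <= (1 + 4 * v) * expR y] for [0 <= y]. *)
Lemma sq_gauss1_le (R : realType) (m v x : R) : 0 < v ->
  (1 + (x - m) ^+ 2) * gauss1 m v x <= (1 + 4 * v) * gauss1 m (2 * v) x.
Proof.
move=> v0; rewrite /gauss1; set y := (x - m) ^+ 2 / (2 * (2 * v)).
have y0 : 0 <= y by rewrite divr_ge0 ?sqr_ge0 // !mulr_ge0 // ltW.
have -> : (x - m) ^+ 2 / (2 * v) = y + y by rewrite /y; field; rewrite gt_eqF.
have -> : (x - m) ^+ 2 = 4 * v * y by rewrite /y; field; rewrite gt_eqF.
rewrite opprD expRD mulrA ler_wpM2r ?expR_ge0 //.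
rewrite expRN ler_pdivrMr ?expR_gt0 //.
have := expR_ge1Dx y; nra.
Qed.

Lemma norm_gauss1_le (R : realType) (m v x : R) : 0 < v ->
  `|x - m| * gauss1 m v x <= (1 + 4 * v) * gauss1 m (2 * v) x.
Proof.
move=> v0; apply: le_trans (sq_gauss1_le m x v0).
rewrite ler_wpM2r ?gauss1_ge0 // -real_normK ?num_real //.
have := normr_ge0 (x - m); set t := `|x - m|; have := sqr_ge0 (t - 1); nra.
Qed.

Lemma gauss1_le2 (R : realType) (m v x : R) : 0 < v ->
  gauss1 m v x <= gauss1 m (2 * v) x.
Proof.
move=> v0; rewrite ler_expR lerN2 ler_wpM2l ?sqr_ge0 // lef_pV2 ?posrE; lra.
Qed.

Lemma integrable_gauss1 (R : realType) (m v : R) : 0 < v ->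
  (@lebesgue_measure R).-integrable [set: R] (EFin \o gauss1 m v).
Proof.
move=> v0; apply/integrableP; split.
  by apply/measurable_EFinP; apply: measurable_gauss1; rewrite gt_eqF.
under eq_integral do rewrite /= ger0_norm ?gauss1_ge0 //.
by rewrite integral_gauss1 // ltry.
Qed.

(** The integrand is the derivative of [- f * gauss1 m v], which vanishes at
    infinity. *)
Lemma stein1 (R : realType) (m v K : R) (f f' : R -> R) : 0 < v ->
  (forall x : R, is_derive x 1 f (f' x)) -> continuous f' ->
  (forall x, `|f x| <= K) -> (forall x, `|f' x| <= K) ->
  (\int[@lebesgue_measure R]_x
     (((x - m) / v * f x - f' x) * gauss1 m v x)%:E = 0)%E.
Proof.
move=> v0 df cf' fK f'K.
have vN0 : v != 0 by rewrite gt_eqF.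
have K0 : 0 <= K by exact: le_trans (normr_ge0 _) (fK 0).
have cf : continuous f.
  by move=> x; apply/differentiable_continuous/derivable1_diffP; have [] := df x.
have cg := @continuous_gauss1 R m v vN0.
pose h x := ((x - m) / v * f x - f' x) * gauss1 m v x.
have ch : continuous h.
  move=> x; apply: cvgM; last exact: cg.
  apply: cvgB; last exact: cf'.
  apply: cvgM; last exact: cf.
  apply: cvgM; last exact: cvg_cst.
  by apply: cvgB; [exact: cvg_id|exact: cvg_cst].
pose F x := - (f x * gauss1 m v x).
have Fb n (x : R) : (x - m) ^+ 2 = n.+1%:R ^+ 2 -> `|F x| <= K * (2 * v) / n.+1%:R.
  move=> xm; rewrite normrN normrM -mulrA ler_pM // ger0_norm ?gauss1_ge0 //.
  rewrite /gauss1 xm expRN -[leRHS]invrK lef_pV2 ?posrE ?expR_gt0 //; last first.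
    by rewrite invr_gt0 divr_gt0 // mulr_gt0.
  rewrite invf_div; apply: (le_trans _ (expR_ge1Dx _)).
  rewrite -[leLHS]add0r lerD // ler_wpM2r // ?invr_ge0; first by lra.
  by rewrite expr2 ler_peMl // ler1n.
apply: (@integral_derive_eq0 _ F h m (K * (2 * v))) => //.
- move=> x; have dg := is_derive_gauss1 m x vN0.
  by apply: is_derive_eq; rewrite /h /GRing.scale /=; ring.
- have ig : (@lebesgue_measure R).-integrable [set: R]
      (fun x => ((K * (1 + 4 * v) / v + K) * gauss1 m (2 * v) x)%:E).
    under eq_fun do rewrite EFinM.
    by apply: integrableZl => //; apply: integrable_gauss1; lra.
  apply: (le_integrable _ _ _ ig) => //.
  + by apply/measurable_EFinP; apply: continuous_measurable_fun.
  + move=> x _; rewrite lee_fin /h normrM (ger0_norm (gauss1_ge0 _ _ _)).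
    rewrite [leRHS]ger0_norm; last first.
      rewrite mulr_ge0 ?gauss1_ge0 // addr_ge0 // divr_ge0 ?(ltW v0) //.
      by rewrite mulr_ge0 //; lra.
    apply: (@le_trans _ _ ((`|x - m| / v * K + K) * gauss1 m v x)).
      rewrite ler_wpM2r ?gauss1_ge0 // (le_trans (ler_normB _ _)) // lerD //.
      by rewrite normrM ler_pM // normrM normfV (gtr0_norm v0).
    rewrite [leLHS]mulrDl [leRHS]mulrDl; apply: lerD.
      rewrite [leLHS](_ : _ = K / v * (`|x - m| * gauss1 m v x)); last by ring.
      rewrite [leRHS](_ : _ = K / v * ((1 + 4 * v) * gauss1 m (2 * v) x)); last by ring.
      by rewrite ler_wpM2l ?norm_gauss1_le // divr_ge0 // ltW.
    by rewrite ler_wpM2l // gauss1_le2.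
- by move=> n; apply: Fb; rewrite addrAC subrr add0r.
- by move=> n; apply: Fb; rewrite addrAC subrr add0r sqrrN.
Qed.

(** Stein's identity for a constant function. *)
Lemma integral_gauss1_mean (R : realType) (m v : R) : 0 < v ->
  (\int[@lebesgue_measure R]_x ((x - m) * gauss1 m v x)%:E = 0)%E.
Proof.
move=> v0.
have := @stein1 R m v v (fun=> v) (fun=> 0) v0.
move=> <- //.
- by apply: eq_integral => x _; rewrite subr0 divfK ?gt_eqF.
- by move=> x; exact: cvg_cst.
- by move=> x; rewrite ger0_norm // ltW.
- by move=> x; rewrite normr0 ltW.
Qed.

(** * Posterior means for scale mixtures of normal priors *)

Lemma measurable_inv (R : realType) : measurable_fun [set: R] (@GRing.inv R).
Proof.
rewrite (_ : @GRing.inv R = fun x => x * (x ^+ 2) `^ (-1)).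
  apply: measurable_funM => //; apply: (measurableT_comp (measurable_powR (-1))).
  exact: measurable_funX.
apply/funext => x; rewrite powR_inv1 ?sqr_ge0 //.
have [->|x0] := eqVneq x 0; first by rewrite invr0 mul0r.
by rewrite expr2 invfM mulrA divff // mul1r.
Qed.

Lemma measurable_tnth_real (R : realType) (p : nat) (i : 'I_p) :
  measurable_fun [set: vec R p] (fun z : vec R p => tnth z i : R).
Proof. exact: measurable_tnth. Qed.

Lemma measurable_sqnorm (R : realType) (p : nat) :
  measurable_fun [set: vec R p] (@sqnorm R p).
Proof.
apply: measurable_sum => i; apply: measurable_funX; exact: measurable_tnth.
Qed.

Lemma sqnorm_ge0 (R : realType) (p : nat) (z : vec R p) : 0 <= sqnorm z.
Proof. by apply: sumr_ge0 => i _; rewrite sqr_ge0. Qed.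

Lemma sqr_enorm (R : realType) (p : nat) (z : vec R p) : enorm z ^+ 2 = sqnorm z.
Proof. by rewrite sqr_sqrtr // sqnorm_ge0. Qed.

Lemma sqnorm_vsub (R : realType) (p : nat) (z m : vec R p) :
  sqnorm (vsub z m) = \sum_(i < p) (tnth z i - tnth m i) ^+ 2.
Proof. by apply: eq_bigr => i _; rewrite tnth_mktuple. Qed.

Lemma measurable_sqnorm_vsub (R : realType) (p : nat) (z : vec R p) :
  measurable_fun [set: vec R p] (fun m => sqnorm (vsub z m)).
Proof.
under eq_fun do rewrite sqnorm_vsub.
apply: measurable_sum => i; apply: measurable_funX.
apply: measurable_funB => //; exact: measurable_tnth.
Qed.

Lemma powR_half (R : realType) (x : R) (n : nat) : 0 <= x ->
  x `^ (n%:R / 2) = Num.sqrt x ^+ n.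
Proof.
by move=> x0; rewrite mulrC powRrM powR12_sqrt // powR_mulrn ?sqrtr_ge0.
Qed.

Definition normal1 (R : realType) (m v x : R) : R :=
  gauss1 m v x / Num.sqrt (2 * pi * v).

Lemma normal1_ge0 (R : realType) (m v x : R) : 0 <= normal1 m v x.
Proof. by rewrite divr_ge0 ?gauss1_ge0 ?sqrtr_ge0. Qed.

Lemma measurable_normal1 (R : realType) (m v : R) : v != 0 ->
  measurable_fun [set: R] (normal1 m v).
Proof. by move=> v0; apply: measurable_funM => //; exact: measurable_gauss1. Qed.

Lemma integral_normal1 (R : realType) (m v : R) : 0 < v ->
  (\int[@lebesgue_measure R]_x (normal1 m v x)%:E = 1)%E.
Proof.
move=> v0; under eq_integral do rewrite /normal1 mulrC EFinM.
rewrite ge0_integralZl_EFin //.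
- rewrite integral_gauss1 // -EFinM mulVf // gt_eqF // sqrtr_gt0.
  by rewrite !mulr_gt0 // pi_gt0.
- by move=> x _; rewrite lee_fin gauss1_ge0.
- by apply/measurable_EFinP; apply: measurable_gauss1; rewrite gt_eqF.
Qed.

Lemma integrable_normal1 (R : realType) (m v : R) : 0 < v ->
  (@lebesgue_measure R).-integrable [set: R] (EFin \o normal1 m v).
Proof.
move=> v0; apply/integrableP; split.
  by apply/measurable_EFinP; apply: measurable_normal1; rewrite gt_eqF.
under eq_integral do rewrite /= ger0_norm ?normal1_ge0 //.
by rewrite integral_normal1 // ltry.
Qed.

(** Only uniformity in [v] matters: it makes the conditional posterior means
    bounded in the mixing variable. *)
Lemma integral_norm_normal1_le (R : realType) (m v : R) : 0 < v <= 1 ->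
  (\int[@lebesgue_measure R]_x (`|x| * normal1 m v x)%:E <= (`|m| + 10)%:E)%E.
Proof.
move=> /andP[v0 v1]; have v20 : 0 < 2 * v by lra.
have vN0 : v != 0 by rewrite gt_eqF.
have pi0 : 0 < pi :> R := pi_gt0 R.
pose b x := `|m| * normal1 m v x + (1 + 4 * v) * Num.sqrt 2 * normal1 m (2 * v) x.
apply: (@le_trans _ _ (\int[@lebesgue_measure R]_x (b x)%:E)%E).
  apply: ge0_le_integral => //.
  - by move=> x _; rewrite lee_fin mulr_ge0 ?normal1_ge0.
  - apply/measurable_EFinP; apply: measurable_funM; last exact: measurable_normal1.
    exact: normr_measurable.
  - apply/measurable_EFinP; apply: measurable_funD; apply: measurable_funM => //;
    by apply: measurable_normal1; rewrite gt_eqF.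
  move=> x _; rewrite lee_fin /b.
  apply: (@le_trans _ _ ((`|m| + `|x - m|) * normal1 m v x)).
    rewrite ler_wpM2r ?normal1_ge0 // (le_trans _ (ler_normD _ _)) //.
    by rewrite addrCA subrr addr0.
  rewrite mulrDl lerD2l /normal1 [leLHS]mulrA.
  have -> : Num.sqrt (2 * pi * (2 * v)) = Num.sqrt 2 * Num.sqrt (2 * pi * v).
    by rewrite -sqrtrM //; congr Num.sqrt; ring.
  have s2 : Num.sqrt 2 != 0 :> R by rewrite gt_eqF // sqrtr_gt0.
  have c0 : Num.sqrt (2 * pi * v) != 0.
    by rewrite gt_eqF // sqrtr_gt0 !mulr_gt0.
  rewrite [leRHS](_ : _ = (1 + 4 * v) * gauss1 m (2 * v) x / Num.sqrt (2 * pi * v)).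
    by rewrite ler_wpM2r ?invr_ge0 ?sqrtr_ge0 //; exact: norm_gauss1_le.
  by field; rewrite s2 c0.
rewrite /b; set C := (1 + 4 * v) * Num.sqrt 2.
have C0 : 0 <= C by rewrite mulr_ge0 ?sqrtr_ge0 //; lra.
under eq_integral do rewrite EFinD.
rewrite ge0_integralD //; last 4 first.
- by move=> x _; rewrite lee_fin mulr_ge0 ?normal1_ge0.
- apply/measurable_EFinP; apply: measurable_funM => //; exact: measurable_normal1.
- by move=> x _; rewrite lee_fin mulr_ge0 ?normal1_ge0.
- apply/measurable_EFinP; apply: measurable_funM => //; apply: measurable_normal1.
  by rewrite gt_eqF.
under eq_integral do rewrite EFinM.
rewrite integralZl //; last exact: integrable_normal1.
under [X in (_ + X)%E]eq_integral do rewrite EFinM.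
rewrite integralZl //; last exact: integrable_normal1.
rewrite !integral_normal1 // !mule1 -EFinD lee_fin lerD2l /C.
have s2 : Num.sqrt 2 <= 2 :> R.
  by rewrite -[leRHS]ger0_norm // -sqrtr_sqr ler_sqrt ?sqr_ge0 //; lra.
have := sqrtr_ge0 (2 : R); nra.
Qed.

Section normal1_parts.
Context (R : realType) (m v : R) (v01 : 0 < v <= 1).

Lemma integrable_id_normal1 : (@lebesgue_measure R).-integrable [set: R]
  (fun x => (x * normal1 m v x)%:E).
Proof.
case/andP: (v01) => v0 _; apply/integrableP; split.
  apply/measurable_EFinP; apply: measurable_funM => //.
  by apply: measurable_normal1; rewrite gt_eqF.
under eq_integral do rewrite /= normrM (ger0_norm (normal1_ge0 _ _ _)).
exact: le_lt_trans (integral_norm_normal1_le m v01) (ltry _).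
Qed.

Lemma integral_id_normal1 :
  (\int[@lebesgue_measure R]_x (x * normal1 m v x)%:E = m%:E)%E.
Proof.
case/andP: (v01) => v0 _.
have E : (\int[@lebesgue_measure R]_x ((x - m) * normal1 m v x)%:E = 0)%E.
  have := integral_gauss1_mean m v0.
  set c := Num.sqrt (2 * pi * v) => E.
  have c0 : c != 0 by rewrite gt_eqF // sqrtr_gt0 !mulr_gt0 // pi_gt0.
  under eq_integral => x _ do rewrite /normal1 mulrA mulrC EFinM.
  rewrite integralZl ?E ?mule0 //.
  have := integrableB measurableT integrable_id_normal1
    (integrableZl measurableT m (integrable_normal1 m v0)).
  move/(integrableZl measurableT c).
  apply: eq_integrable => // x _ /=.
  by rewrite -EFinD -EFinM /normal1 -/c; congr EFin; field.
have Em : (\int[@lebesgue_measure R]_x (m * normal1 m v x)%:E = m%:E)%E.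
  under eq_integral do rewrite EFinM.
  rewrite integralZl //; last exact: integrable_normal1.
  by rewrite integral_normal1 // mule1.
have : (\int[@lebesgue_measure R]_x (x * normal1 m v x)%:E - m%:E = 0)%E.
  rewrite -Em -integralB_EFin //; last 2 first.
  - exact: integrable_id_normal1.
  - exact: (integrableZl measurableT m (integrable_normal1 m v0)).
  by rewrite -E; apply: eq_integral => x _; rewrite -EFinB mulrBl.
have /fineK <- := integrable_fin_num measurableT integrable_id_normal1.
by rewrite -EFinB => -[/eqP]; rewrite subr_eq0 => /eqP ->.
Qed.

(** The positive and the negative part of a normal variable have finite means
    whose difference is [m]; the bounds do not depend on [v]. *)
Lemma integral_parts_normal1 : exists a b : R,
  [/\ (\int[@lebesgue_measure R]_x (Num.max x 0 * normal1 m v x)%:E = a%:E)%E,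
      (\int[@lebesgue_measure R]_x (Num.max (- x) 0 * normal1 m v x)%:E = b%:E)%E,
      0 <= a <= `|m| + 10, 0 <= b <= `|m| + 10 & a - b = m].
Proof.
case/andP: (v01) => v0 _; have vN0 : v != 0 by rewrite gt_eqF.
have key (h : R -> R) : measurable_fun [set: R] h ->
    (forall x, 0 <= h x <= `|x|) -> 
    (@lebesgue_measure R).-integrable [set: R] (fun x => (h x * normal1 m v x)%:E)
    /\ exists a, (\int[@lebesgue_measure R]_x (h x * normal1 m v x)%:E = a%:E)%E
      /\ 0 <= a <= `|m| + 10.
  move=> mh hx.
  have mhn : measurable_fun [set: R] (fun x => (h x * normal1 m v x)%:E).
    apply/measurable_EFinP; apply: measurable_funM => //; exact: measurable_normal1.
  have le1 : (\int[@lebesgue_measure R]_x (h x * normal1 m v x)%:E <=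
      (`|m| + 10)%:E)%E.
    apply: le_trans (integral_norm_normal1_le m v01).
    apply: ge0_le_integral => //.
    - by move=> x _; rewrite lee_fin mulr_ge0 ?normal1_ge0 //; case/andP: (hx x).
    - apply/measurable_EFinP; apply: measurable_funM; last exact: measurable_normal1.
      exact: normr_measurable.
    - move=> x _; rewrite lee_fin ler_wpM2r ?normal1_ge0 //.
      by case/andP: (hx x).
  have ge0 : (0 <= \int[@lebesgue_measure R]_x (h x * normal1 m v x)%:E)%E.
    apply: integral_ge0 => x _; rewrite lee_fin mulr_ge0 ?normal1_ge0 //.
    by case/andP: (hx x).
  split.
    apply/integrableP; split => //.
    have h0 x : 0 <= h x by case/andP: (hx x).
    rewrite [ltLHS](_ : _ = (\int[@lebesgue_measure R]_x
        (h x * normal1 m v x)%:E)%E); last first.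
      by apply: eq_integral => x _; rewrite /= ger0_norm // mulr_ge0 ?normal1_ge0.
    exact: le_lt_trans le1 (ltry _).
  move: ge0 le1; case: integral => //= a; rewrite !lee_fin => a0 a1.
  by exists a; rewrite a0 a1.
have [||i1 [a [aE a01]]] := key (fun x => Num.max x 0).
- exact: measurable_maxr.
- by move=> x; rewrite le_max lexx orbT ge_max ler_norm normr_ge0.
have [||i2 [b [bE b01]]] := key (fun x => Num.max (- x) 0).
- by apply: measurable_maxr => //; exact: oppr_measurable.
- by move=> x; rewrite le_max lexx orbT ge_max -normrN ler_norm normr_ge0.
exists a, b; split => //; apply: EFin_inj.
rewrite EFinB -aE -bE -integralB_EFin // -integral_id_normal1.
apply: eq_integral => x _; rewrite -EFinB -mulrBl; congr (_ * _)%:E.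
rewrite !maxEle; case: (leP x 0) => ?; case: (leP (- x) 0) => ?; lra.
Qed.

End normal1_parts.

(** The law of [mu] given [z] and the mixing variable [l]: normal, with
    independent coordinates, mean [(1 - l) z] and variance [1 - l]. *)
Definition posterior_pdf (R : realType) (p : nat) (z : vec R p) (l : R)
    (m : vec R p) : R :=
  \prod_(i < p) normal1 ((1 - l) * tnth z i) (1 - l) (tnth m i).

(** Completing the square, coordinate by coordinate. *)
Lemma density_posterior_pdf (R : realType) (p : nat) (z m : vec R p) (l : R) :
  0 < l < 1 ->
  std_normal_density m z *
    ((1 - l) `^ (- (p%:R / 2)) * expR (- (l / (1 - l) * (sqnorm m / 2)))) =
  expR (- (l * sqnorm z / 2)) * posterior_pdf z l m.
Proof.
move=> /andP[l0 l1]; have l1' : 0 < 1 - l by lra.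
have pi0 : 0 < pi :> R := pi_gt0 R.
have -> : posterior_pdf z l m = (2 * pi) `^ (- (p%:R / 2)) *
    (1 - l) `^ (- (p%:R / 2)) *
    \prod_(i < p) gauss1 ((1 - l) * tnth z i) (1 - l) (tnth m i).
  rewrite /posterior_pdf /normal1 big_split /= mulrC; congr (_ * _).
  rewrite prodr_const card_ord exprVn -powR_half; last by rewrite !mulr_ge0 // ltW.
  rewrite -powRN powRM //; last by rewrite ltW.
  by rewrite mulr_ge0 // ltW.
rewrite /std_normal_density /gauss1 -expR_sum.
rewrite -!mulrA [RHS]mulrCA; congr (_ * _).
rewrite mulrCA [RHS]mulrCA; congr (_ * _); rewrite -!expRD; congr expR.
rewrite sqnorm_vsub /sqnorm.
rewrite sumrN -!opprD; congr (- _).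
rewrite !mulr_suml !mulr_sumr -!big_split /=; apply: eq_bigr => i _.
by field; rewrite gt_eqF.
Qed.

(** The Laplace transform of [W] at [w / 2]; with this normalization the
    argument is the squared norm of the observation. *)
Definition laplace (R : realType) (W : R -> R) (w : R) : \bar R :=
  (\int[@lebesgue_measure R]_l (W l * expR (- (l * w / 2)))%:E)%E.

Section mixture.
Context (R : realType) (p : nat) (W : R -> R).
Hypothesis mW : measurable_fun [set: R] W.
Hypothesis W0 : forall l : R, 0 <= W l.
Hypothesis Wout : forall l : R, ~~ (0 < l < 1) -> W l = 0.

(** The factor [(1 - l) `^ (- (p / 2))] is kept apart from [W], because it is the
    normalizing factor of the conditional posterior. *)
Definition mixture_prior (m : vec R p) : \bar R :=
  (\int[@lebesgue_measure R]_l
    (W l * ((1 - l) `^ (- (p%:R / 2)) *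
            expR (- (l / (1 - l) * (sqnorm m / 2)))))%:E)%E.

Let kern (m : vec R p) (l : R) : R :=
  W l * ((1 - l) `^ (- (p%:R / 2)) * expR (- (l / (1 - l) * (sqnorm m / 2)))).

Let mkern : measurable_fun [set: vec R p * measurableTypeR R]
  (fun x => kern x.1 x.2).
Proof.
have m1l : measurable_fun [set: vec R p * measurableTypeR R]
    (fun x : vec R p * measurableTypeR R => 1 - x.2 : R).
  by apply: measurable_funB => //; exact: measurable_snd.
apply: measurable_funM.
  by apply: (measurableT_comp mW); exact: measurable_snd.
apply: measurable_funM.
  exact: (measurableT_comp (measurable_powR (- (p%:R / 2)))).
apply: (measurableT_comp (@measurable_expR R)).
apply: measurableT_comp => //; apply: measurable_funM.
  apply: measurable_funM; first exact: measurable_snd.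
  exact: (measurableT_comp (@measurable_inv R)).
apply: measurable_funM => //.
by apply: (measurableT_comp (@measurable_sqnorm R p)); exact: measurable_fst.
Qed.

Lemma measurable_std_normal_density (z : vec R p) :
  measurable_fun [set: vec R p] (fun m => std_normal_density m z).
Proof.
apply: measurable_funM => //; apply: (measurableT_comp (@measurable_expR R)).
apply: measurableT_comp => //; apply: measurable_funM => //.
exact: measurable_sqnorm_vsub.
Qed.

Lemma std_normal_density_ge0 (m z : vec R p) : 0 <= std_normal_density m z.
Proof. by rewrite mulr_ge0 ?powR_ge0 ?expR_ge0. Qed.

Lemma posterior_pdf_ge0 (z m : vec R p) (l : R) : 0 <= posterior_pdf z l m.
Proof.
by apply: prodr_ge0 => i _; rewrite divr_ge0 ?gauss1_ge0 ?sqrtr_ge0.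
Qed.

(** Tonelli's theorem exchanges [mu] and the mixing variable, after which the
    joint density factors into the weight of [l] given [z] and the conditional
    posterior density. *)
Lemma integral_mixture_prior (k : vec R p -> R) (z : vec R p) :
  measurable_fun [set: vec R p] k -> (forall m, 0 <= k m) ->
  let g l := ((W l * expR (- (l * sqnorm z / 2)))%:E *
      \int[@lebesgue_vec R p]_m (k m * posterior_pdf z l m)%:E)%E in
  measurable_fun [set: R] g /\
  (\int[@lebesgue_vec R p]_m
     ((k m * std_normal_density m z)%:E * mixture_prior m) =
   \int[@lebesgue_measure R]_l g l)%E.
Proof.
move=> mk k0 g.
pose f (x : vec R p * measurableTypeR R) : \bar R :=
  ((k x.1 * std_normal_density x.1 z * kern x.1 x.2)%:E)%E.
have kern0 m l : 0 <= kern m l by rewrite !mulr_ge0 ?powR_ge0 ?expR_ge0.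
have f0 x : (0 <= f x)%E.
  by rewrite lee_fin mulr_ge0 // mulr_ge0 ?std_normal_density_ge0.
have mf : measurable_fun [set: vec R p * measurableTypeR R] f.
  apply/measurable_EFinP; apply: measurable_funM => //.
  have mkd : measurable_fun [set: vec R p]
      (fun m => k m * std_normal_density m z).
    by apply: measurable_funM => //; exact: measurable_std_normal_density.
  exact: (measurableT_comp mkd measurable_fst).
have gE : (fun l => \int[@lebesgue_vec R p]_m f (m, l))%E = g.
  apply/funext => l; rewrite /g /f /=.
  have [l01|l01] := boolP (0 < l < 1); last first.
    rewrite Wout // mul0r mul0e; apply: integral0_eq => m _.
    by rewrite /kern Wout // mul0r mulr0.
  rewrite -ge0_integralZl_EFin //; last 3 first.
  - by move=> m _; rewrite lee_fin mulr_ge0 // posterior_pdf_ge0.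
  - apply/measurable_EFinP; apply: measurable_funM => //.
    apply: (@measurable_prod_tnth R p
      (fun i => normal1 ((1 - l) * tnth z i) (1 - l))) => i.
    apply: measurable_funM => //; apply: measurable_gauss1.
    by case/andP: l01 => _ l1; rewrite subr_eq0 gt_eqF.
  - by rewrite mulr_ge0 ?expR_ge0.
  apply: eq_integral => m _; rewrite -EFinM; congr EFin.
  have := density_posterior_pdf z m l01; rewrite /kern.
  set u := (1 - l) `^ _ * _; move=> du.
  transitivity (k m * W l * (std_normal_density m z * u)); first by ring.
  by rewrite du; ring.
split; first by rewrite -gE; exact: measurable_fun_fubini_tonelli_G.
rewrite -gE -fubini_tonelli //.
apply: eq_integral => m _; rewrite /mixture_prior -ge0_integralZl_EFin //.
- by move=> l _; rewrite lee_fin; exact: kern0.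
- by apply/measurable_EFinP; exact: (measurableT_comp mkern (pair1_measurable m)).
- by rewrite mulr_ge0 ?std_normal_density_ge0.
Qed.

(** The coordinates are independent under the conditional posterior, so that all
    factors but the [i]-th integrate to 1. *)
Lemma integral_coord_posterior (z : vec R p) (l : R) (i : 'I_p) (h : R -> R) c :
  0 < l < 1 -> measurable_fun [set: R] h -> (forall x, 0 <= h x) ->
  (\int[@lebesgue_measure R]_x
     (h x * normal1 ((1 - l) * tnth z i) (1 - l) x)%:E = c%:E)%E ->
  (\int[@lebesgue_vec R p]_m (h (tnth m i) * posterior_pdf z l m)%:E = c%:E)%E.
Proof.
move=> /andP[_ l1] mh h0 hc; have v0 : 0 < 1 - l by lra.
pose n j := normal1 ((1 - l) * tnth z j) (1 - l).
pose f j x := if j == i then h x * n j x else n j x.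
have fE (m : vec R p) :
    h (tnth m i) * posterior_pdf z l m = \prod_(j < p) f j (tnth m j).
  rewrite /posterior_pdf (bigD1 i) //= [RHS](bigD1 i) //= /f eqxx mulrA.
  by congr (_ * _); apply: eq_bigr => j /negbTE ->.
have mn j : measurable_fun [set: R] (n j).
  by apply: measurable_normal1; rewrite gt_eqF.
under eq_integral do rewrite fE.
rewrite (@ge0_integral_vec_prod R p f (fun j => if j == i then c else 1)).
- by rewrite (bigD1 i) //= eqxx big1 ?mulr1 // => j /negbTE ->.
- by rewrite /f => j; case: (j == i) => //; exact: measurable_funM.
- move=> j x; rewrite /f; case: ifP => _; last exact: normal1_ge0.
  by rewrite mulr_ge0 ?normal1_ge0.
- rewrite /f => j; case: eqVneq => [->//|_]; exact: integral_normal1.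
Qed.

Lemma integral_posterior_pdf (z : vec R p) (l : R) : 0 < l < 1 ->
  (\int[@lebesgue_vec R p]_m (posterior_pdf z l m)%:E = 1)%E.
Proof.
move=> /andP[_ l1]; have v0 : 0 < 1 - l by lra.
rewrite /posterior_pdf (@ge0_integral_vec_prod R p
  (fun i => normal1 ((1 - l) * tnth z i) (1 - l)) (fun=> 1)).
- by rewrite big1.
- by move=> i; apply: measurable_normal1; rewrite gt_eqF.
- by move=> i x; exact: normal1_ge0.
- by move=> i; exact: integral_normal1.
Qed.

Lemma marginal_mixture (z : vec R p) :
  marginal mixture_prior z = laplace W (sqnorm z).
Proof.
have [_] := @integral_mixture_prior (fun=> 1) z (measurable_cst _) (fun=> ler01).
rewrite /marginal; under eq_integral do rewrite mul1r.
move=> ->; apply: eq_integral => l _.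
have [l01|/Wout ->] := boolP (0 < l < 1); last by rewrite !mul0r mul0e.
under eq_integral do rewrite mul1r.
by rewrite integral_posterior_pdf // mule1.
Qed.

(** The conditional posterior mean of the [i]-th coordinate is
    [(1 - l) * tnth z i], to be averaged over [l]. *)
Lemma posterior_moment (z : vec R p) (i : 'I_p) (J0 J1 : R) :
  laplace W (sqnorm z) = J0%:E ->
  laplace (fun l => l * W l) (sqnorm z) = J1%:E ->
  (\int[@lebesgue_vec R p]_m
     ((tnth m i * std_normal_density m z)%:E * mixture_prior m) =
   (tnth z i * (J0 - J1))%:E)%E.
Proof.
move=> E0 E1; set w := sqnorm z in E0 E1 *.
pose e l := W l * expR (- (l * w / 2)).
have e0 l : 0 <= e l by rewrite mulr_ge0 ?expR_ge0.
have me : measurable_fun [set: R] e.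
  apply: measurable_funM => //; apply: (measurableT_comp (@measurable_expR R)).
  apply: measurableT_comp => //; apply: measurable_funM => //.
  by apply: measurable_funM.
have ie : (@lebesgue_measure R).-integrable [set: R] (EFin \o e).
  apply/integrableP; split; first exact/measurable_EFinP.
  rewrite [ltLHS](_ : _ = laplace W w) ?E0 ?ltry //.
  by rewrite -E0; apply: eq_integral => l _; rewrite /= ger0_norm.
pose B := `|tnth z i| + 10.
(* The positive and the negative part of the coordinate are integrated
   separately, since only nonnegative integrands can be exchanged with the
   mixture over [l] without knowing that the prior is finite. *)
have part (h : R -> R) (a : R -> R) : measurable_fun [set: R] h ->
    (forall x, 0 <= h x) ->
    (forall l, 0 < l < 1 -> 0 <= a l <= B /\ (\int[@lebesgue_measure R]_x
     (h x * normal1 ((1 - l) * tnth z i) (1 - l) x)%:E = (a l)%:E)%E) ->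
    (@lebesgue_measure R).-integrable [set: R] (fun l => (e l * a l)%:E) /\
    (\int[@lebesgue_vec R p]_m
     ((h (tnth m i) * std_normal_density m z)%:E * mixture_prior m) =
     \int[@lebesgue_measure R]_l (e l * a l)%:E)%E.
  move=> mh h0 ha.
  have mhi : measurable_fun [set: vec R p] (fun m => h (tnth m i)).
    exact: (measurableT_comp mh (measurable_tnth_real i)).
  have [] := integral_mixture_prior z mhi (fun m => h0 (tnth m i)).
  rewrite -/w (_ : (fun l => _) = fun l => (e l * a l)%:E); last first.
    apply/funext => l; rewrite /e.
    have [l01|/Wout ->] := boolP (0 < l < 1); last by rewrite !mul0r mul0e.
    have [_ hal] := ha l l01.
    by rewrite (integral_coord_posterior l01 mh h0 hal) EFinM.
  move=> mea ->; split => //.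
  have ig := integrableZl measurableT B ie.
  apply: (le_integrable _ _ _ ig) => // l _.
  rewrite -EFinM lee_fin; change (`|e l * a l| <= `|B * e l|).
  rewrite (normrM (e l)) (normrM B) mulrC (ger0_norm (e0 l)).
  have [l01|l01] := boolP (0 < l < 1); last by rewrite /e Wout // !mul0r !mulr0.
  have [/andP[a0 aB] _] := ha l l01.
  by rewrite ler_wpM2r // ger0_norm // (le_trans aB) ?ler_norm.
have /choice[ab abP] : forall l, exists ab : R * R, 0 < l < 1 ->
    [/\ (\int[@lebesgue_measure R]_x (Num.max x 0 *
           normal1 ((1 - l) * tnth z i) (1 - l) x)%:E = ab.1%:E)%E,
        (\int[@lebesgue_measure R]_x (Num.max (- x) 0 *
           normal1 ((1 - l) * tnth z i) (1 - l) x)%:E = ab.2%:E)%E,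
        0 <= ab.1 <= B, 0 <= ab.2 <= B & ab.1 - ab.2 = (1 - l) * tnth z i].
  move=> l; have [l01|] := boolP (0 < l < 1); last by exists (0, 0).
  have v01 : 0 < 1 - l <= 1 by apply/andP; split; lra.
  have [a [b [? ? /andP[? ?] /andP[? ?] ?]]] :=
    integral_parts_normal1 ((1 - l) * tnth z i) v01.
  have ? : `|(1 - l) * tnth z i| + 10 <= B.
    rewrite lerD2r normrM ler_piMl // ger0_norm //; lra.
  exists (a, b) => _; split => //=; apply/andP; split => //; lra.
have [|||ip Ep] := part (fun x => Num.max x 0) (fun l => (ab l).1).
- exact: measurable_maxr.
- by move=> x; rewrite le_max lexx orbT.
- by move=> l /abP[? _ ? _ _].
have [|||im Em] := part (fun x => Num.max (- x) 0) (fun l => (ab l).2).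
- by apply: measurable_maxr => //; exact: oppr_measurable.
- by move=> x; rewrite le_max lexx orbT.
- by move=> l /abP[_ ? _ ? _].
have P0 m : (0 <= mixture_prior m)%E.
  apply: integral_ge0 => l _.
  by rewrite lee_fin !mulr_ge0 ?powR_ge0 ?expR_ge0.
have mx x m : (maxe ((x * std_normal_density m z)%:E * mixture_prior m) 0 =
    (Num.max x 0 * std_normal_density m z)%:E * mixture_prior m)%E.
  have d0 := std_normal_density_ge0 m z.
  rewrite [in RHS]maxEle; case: (leP x 0) => x0.
    by rewrite mul0r mul0e max_r // mule_le0_ge0 // lee_fin mulr_le0_ge0.
  by rewrite max_l // mule_ge0 // lee_fin mulr_ge0 // ltW.
rewrite integralE.
under eq_integral do rewrite funeposE mx.
under [X in (_ - X)%E]eq_integral do rewrite funenegE -mulNe -EFinN -mulNr mx.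
rewrite Ep Em -integralB_EFin //.
have ile : (@lebesgue_measure R).-integrable [set: R] (fun l => (l * e l)%:E).
  apply: (le_integrable _ _ _ ie) => // [|l _].
    by apply/measurable_EFinP; exact: measurable_funM.
  change ((`|l * e l|)%:E <= (`|e l|)%:E)%E.
  rewrite lee_fin (normrM l) (ger0_norm (e0 l)).
  have [/andP[l0 l1]|l01] := boolP (0 < l < 1).
    by rewrite ler_piMl // ger0_norm ltW.
  by rewrite /e Wout // mul0r mulr0.
transitivity (\int[@lebesgue_measure R]_l
    ((tnth z i)%:E * ((e l)%:E - (l * e l)%:E)))%E.
  apply: eq_integral => l _; rewrite -!EFinB -EFinM; congr EFin.
  have [l01|l01] := boolP (0 < l < 1); last by rewrite /e Wout // !mul0r; ring.
  by have [_ _ _ _ E] := abP l l01; rewrite -mulrBr E; ring.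
rewrite integralZl //; last exact: (integrableB measurableT ie ile).
rewrite integralB_EFin // (EFinM (tnth z i)) EFinB -E0 -E1.
congr (_ * (_ - _))%E.
by apply: eq_integral => l _; rewrite /e mulrA.
Qed.

Lemma gen_bayes_mixture (z : vec R p) (i : 'I_p) (J0 J1 : R) :
  laplace W (sqnorm z) = J0%:E -> J0 != 0 ->
  laplace (fun l => l * W l) (sqnorm z) = J1%:E ->
  tnth (gen_bayes mixture_prior z) i = (1 - J1 / J0) * tnth z i.
Proof.
move=> E0 J00 E1; rewrite tnth_mktuple marginal_mixture E0.
by rewrite (posterior_moment i E0 E1) /=; field.
Qed.
End mixture.

(** * Slowly varying functions with monotone derivative *)

Section slowly_varying.
Context (R : realType) (L : R -> R).
Hypothesis L_ge0 : forall y, 1 <= y -> 0 <= L y.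
Hypothesis L1 : slowly_varying L.
Hypothesis L3 : differentiable_from 1 L.

Lemma slowly_varying_gt0 : \forall y \near +oo, 0 < L y.
Proof.
near=> y.
have : `|1 - L (1 * y) / L y| < 1.
  by near: y; move/cvgrPdist_lt: (L1 (@ltr01 R)); apply.
have [->|Ly0 _] := eqVneq (L y) 0.
  by rewrite invr0 mulr0 subr0 normr1 ltxx.
by rewrite lt_neqAle eq_sym Ly0 L_ge0.
Unshelve. all: by end_near. Qed.

Lemma slowly_varying_dist (c d : R) : 0 < c -> 0 < d ->
  \forall y \near +oo, `|L (c * y) - L y| <= d * L y.
Proof.
move=> c0 d0; near=> y.
have Ly : 0 < L y by near: y; exact: slowly_varying_gt0.
have : `|1 - L (c * y) / L y| <= d.
  by near: y; move/cvgrPdist_le: (L1 c0); apply.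
move=> le_d.
have -> : L (c * y) - L y = - ((1 - L (c * y) / L y) * L y).
  by field; rewrite gt_eqF.
by rewrite normrN normrM (gtr0_norm Ly) ler_pM2r.
Unshelve. all: by end_near. Qed.

Lemma is_derive_L (x : R) : 1 < x -> is_derive x 1 L (L^`()%classic x).
Proof. by move=> x1; rewrite derive1E; apply: derivableP; exact: L3.1. Qed.

Lemma continuous_L (x : R) : 1 < x -> {for x, continuous L}.
Proof.
by move=> x1; apply/differentiable_continuous/derivable1_diffP; exact: L3.1.
Qed.

Lemma MVT_L (x y : R) : 1 < x < y ->
  exists2 c, x <= c <= y & L y - L x = L^`()%classic c * (y - x).
Proof.
move=> /andP[x1 xy].
have [||c] := @MVT _ L (L^`()%classic) x y xy.
- move=> z; rewrite in_itv /= => /andP[xz _]; apply: is_derive_L.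
  exact: lt_trans xz.
- apply/continuous_within_itvP => //; split.
  + move=> z; rewrite in_itv /= => /andP[xz _]; apply: continuous_L.
    exact: lt_trans xz.
  + by apply: cvg_at_right_filter; exact: continuous_L.
  + by apply: cvg_at_left_filter; apply: continuous_L; exact: lt_trans xy.
rewrite in_itv /= => /andP[xc cy] E; exists c => //.
by rewrite !ltW.
Qed.

(** The derivative at [y] lies between the slopes of [L] over [[y / 2, y]] and
    over [[y, 2 * y]], which slow variation makes small compared to [L y / y]. *)
Lemma slowly_varying_derive1 (d : R) : ultimately_monotone L^`()%classic ->
  0 < d -> \forall y \near +oo, `|y * L^`()%classic y| <= d * L y.
Proof.
move=> mono d0; have d20 : 0 < d / 2 by lra.
have [y0 Hy0] : exists y0, forall x y z, y0 <= x -> x <= y <= z ->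
    (L^`()%classic x <= L^`()%classic y <= L^`()%classic z) ||
    (L^`()%classic z <= L^`()%classic y <= L^`()%classic x).
  case: mono => -[y0 H]; exists y0 => x y z x0 /andP[xy yz]; apply/orP; [left|right];
    have ? := le_trans x0 xy; have ? := le_trans (le_trans x0 xy) yz;
    by apply/andP; split; apply: H; rewrite ?in_itv /= ?andbT.
near=> y.
have y1 : 2 * 1 < y by near: y; apply: nbhs_pinfty_gt; rewrite num_real.
have yy0 : 2 * y0 <= y by near: y; apply: nbhs_pinfty_ge; rewrite num_real.
have D2 : `|L (2 * y) - L y| <= d * L y.
  by near: y; apply: slowly_varying_dist.
have Dh : `|L (2^-1 * y) - L y| <= d / 2 * L y.
  by near: y; apply: slowly_varying_dist.
have [|c /andP[c1 c2] Ec] := @MVT_L y (2 * y); first by apply/andP; split; lra.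
have [|b /andP[b1 b2] Eb] := @MVT_L (2^-1 * y) y; first by apply/andP; split; lra.
have y0b : y0 <= b by lra.
have byc : b <= y <= c by rewrite b2 c1.
have := Hy0 b y c y0b byc.
set u := L^`()%classic y in Ec Eb *.
move: D2 Dh; rewrite Ec -[L (_ * y) - _]opprB Eb normrN !ler_norml.
move=> /andP[? ?] /andP[? ?] /orP[|] /andP[? ?]; apply/andP; split; nra.
Unshelve. all: by end_near. Qed.
Hypothesis L'_mono : ultimately_monotone L^`()%classic.

Let f (s y : R) := L y * y `^ s.

Let is_derive_f (s x : R) : 1 < x ->
  is_derive x 1 (f s) (x `^ (s - 1) * (x * L^`()%classic x + s * L x)).
Proof.
move=> x1; have x0 : 0 < x by lra.
have dL := is_derive_L x1; have dp := is_derive1_powR s x0.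
have -> : x `^ (s - 1) * (x * L^`()%classic x + s * L x) =
    L^`()%classic x * x `^ s + L x * (s * x `^ (s - 1)).
  have -> : x `^ s = x * x `^ (s - 1).
    rewrite -[X in X * _](powRr1 (ltW x0)) -powRD ?(gt_eqF x0) ?implybT //.
    by congr (_ `^ _); ring.
  ring.
apply: is_derive_eq; rewrite /GRing.scale /=; ring.
Qed.

Let within_f (s Y : R) : 1 < Y -> {within `[Y, +oo[, continuous (f s)}.
Proof.
move=> Y1; apply: continuous_in_subspaceT => x; rewrite inE /= in_itv /= andbT => Yx.
apply/differentiable_continuous/derivable1_diffP.
by have [] := is_derive_f s (lt_le_trans Y1 Yx).
Qed.

(** The derivative of [y |-> L y * y `^ s] has the sign of
    [y * L' y + s * L y], whose first term is eventually negligible. *)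
Lemma slowly_varying_powR_mono (d : R) : 0 < d ->
  \forall Y \near +oo, forall x y, Y <= x -> x <= y ->
    L x * x `^ d <= L y * y `^ d /\ L y * y `^ (- d) <= L x * x `^ (- d).
Proof.
move=> d0; have [M [_ HM]] := slowly_varying_derive1 L'_mono d0.
near=> Y.
have Y1 : 1 < Y by near: Y; apply: nbhs_pinfty_gt; rewrite num_real.
have MY : M < Y by near: Y; apply: nbhs_pinfty_gt; rewrite num_real.
have dP s x : x \in `]Y, +oo[%R -> derivable (f s) x 1 /\
    (f s)^`()%classic x = x `^ (s - 1) * (x * L^`()%classic x + s * L x).
  rewrite in_itv /= andbT => Yx.
  by have [? <-] := is_derive_f s (lt_trans Y1 Yx); rewrite derive1E.
have sgn x : x \in `]Y, +oo[%R -> `|x * L^`()%classic x| <= d * L x.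
  by rewrite in_itv /= andbT => Yx; apply: HM; exact: lt_trans Yx.
move=> x y Yx xy; split.
  apply: (@ger0_derive1_ndecry _ (f d) Y) => //.
  - by move=> z /(dP d)[].
  - move=> z Yz; rewrite (dP d z Yz).2 mulr_ge0 ?powR_ge0 //.
    by have := sgn z Yz; rewrite ler_norml => /andP[? ?]; lra.
  - exact: within_f.
apply: (@ler0_derive1_nincry _ (f (- d)) Y) => //.
- by move=> z /(dP (- d))[].
- move=> z Yz; rewrite (dP (- d) z Yz).2 mulr_ge0_le0 ?powR_ge0 //.
  by have := sgn z Yz; rewrite ler_norml => /andP[? ?]; lra.
- exact: within_f.
Unshelve. all: by end_near. Qed.

(** At infinity this follows from the eventual monotonicity of
    [y |-> L y * y `^ (- d)]; on a compact interval [[1, Y]] it follows from the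
    continuity of [L], which at 1 comes from its one-sided differentiability. *)
Lemma slowly_varying_le_powR (d : R) : 0 < d ->
  exists C, 0 < C /\ forall y, 1 < y -> L y <= C * y `^ d.
Proof.
move=> d0; have [M [_ HM]] := slowly_varying_powR_mono d0.
pose Y := Num.max M 1 + 1.
have MY : M < Y by rewrite /Y ltr_pwDr // le_max lexx.
have Y1 : 1 < Y by rewrite /Y ltr_pwDr // le_max lexx orbT.
have cL : {within `[1, Y], continuous L}.
  apply/continuous_within_itvP => //; split.
  - by move=> x; rewrite in_itv /= => /andP[? _]; exact: continuous_L.
  - case: L3 => _ /cvg_ex[l Hl].
    have /cvgrPdist_le H0 : h * (h^-1 * (L (1 + h) - L 1)) @[h --> 0^'+] --> 0 * l.
      apply: (cvgM (cvg_at_right_filter _) Hl); exact: cvg_id.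
    apply/cvgrPdist_le => e e0; have [r /= r0 Hr] := H0 e e0.
    exists r => // x /= xr x1; have x10 : 0 < x - 1 by rewrite subr_gt0.
    have := Hr (x - 1); rewrite mulrA mulfV ?gt_eqF // mul1r mul0r !sub0r !normrN.
    rewrite [1 + _]addrC subrK (distrC (L 1)); apply => //.
    by rewrite /ball_ /= sub0r normrN distrC.
  - by apply: cvg_at_left_filter; exact: continuous_L.
have [c _ Hc] := EVT_max (ltW Y1) cL.
pose C := `|L c| + L Y * Y `^ (- d) + 1.
have LY0 : 0 <= L Y * Y `^ (- d).
  by rewrite mulr_ge0 ?powR_ge0 // L_ge0 // ltW.
have C0 : 0 < C by rewrite /C; have := normr_ge0 (L c); lra.
exists C; split => // y y1.
have yd : 1 <= y `^ d by rewrite -(powRr0 y) ler_powR // ltW.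
have [yY|/ltW Yy] := leP y Y.
  have : L y <= L c by apply: Hc; rewrite in_itv /= yY ltW.
  have Lc := ler_norm (L c) => LyLc; apply: (@le_trans _ _ C); last first.
    by rewrite ler_peMr // ltW.
  by rewrite /C; lra.
have [_] := HM Y MY Y y (lexx _) Yy.
rewrite powRN ler_pdivrMr ?powR_gt0 //; last by lra.
by move/le_trans; apply; rewrite ler_wpM2r ?powR_ge0 // /C; have := normr_ge0 (L c); lra.
Unshelve. all: by end_near. Qed.

End slowly_varying.

(** * The prior as a scale mixture *)

(** What remains of the integrand of [G] when the factors depending on
    [1 - l] and on the mean are set aside. It is extended by zero outside
    ]0, 1[, since [L] is only known on [[1, +oo[]. *)
Definition mixing (R : realType) (p : nat) (a : R) (L : R -> R) (l : R) : R :=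
  if 0 < l < 1 then l `^ (p%:R / 2 + a) * L l^-1 else 0.

Lemma inv_gt1 (R : realType) (l : R) : 0 < l < 1 -> 1 < l^-1.
Proof. by move=> /andP[l0 l1]; rewrite invf_gt1. Qed.

Lemma mixing_out (R : realType) (p : nat) (a : R) (L : R -> R) (l : R) :
  ~~ (0 < l < 1) -> mixing p a L l = 0.
Proof. by rewrite /mixing => /negbTE ->. Qed.

Lemma mixing_ge0 (R : realType) (p : nat) (a : R) (L : R -> R) (l : R) :
  (forall y, 1 <= y -> 0 <= L y) -> 0 <= mixing p a L l.
Proof.
move=> L0; rewrite /mixing; case: ifPn => // l01.
by rewrite mulr_ge0 ?powR_ge0 // L0 // ltW // inv_gt1.
Qed.

Lemma measurable_mixing (R : realType) (p : nat) (a : R) (L : R -> R) :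
  differentiable_from 1 L -> measurable_fun [set: R] (mixing p a L).
Proof.
move=> L3.
rewrite (_ : mixing p a L = (fun l => l `^ (p%:R / 2 + a) * L l^-1) \_ `]0, 1[).
  apply/(measurable_restrictT _ _).1 => //; apply: measurable_funM.
    by apply: measurable_funTS; exact: (measurable_powR (p%:R / 2 + a)).
  apply: open_continuous_measurable_fun; first exact: interval_open.
  move=> l; rewrite inE /= in_itv /= => l01.
  apply: continuous_comp; first by apply: inv_continuous; case/andP: l01 => /gt_eqF ->.
  by apply: (continuous_L L3); exact: inv_gt1.
apply/funext => l; rewrite patchE /mixing.
have -> : (l \in `]0, 1[%classic) = (0 < l < 1) by rewrite mem_setE in_itv.
by [].
Qed.

Lemma prior_density_mixture (R : realType) (p : nat) (a : R) (L : R -> R)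
    (m : vec R p) :
  prior_density a L m = mixture_prior (mixing p a L) m.
Proof.
rewrite /prior_density /G integral_mkcond /mixture_prior.
apply: eq_integral => l _; rewrite patchE /mixing.
have -> : (l \in `]0, 1[%classic) = (0 < l < 1) by rewrite mem_setE in_itv.
case: ifPn => [/andP[l0 l1]|_]; last by rewrite mul0r.
rewrite sqr_enorm; congr EFin.
rewrite powRM ?invr_ge0 ?subr_ge0 ?ltW // powRD; last by rewrite (gt_eqF l0) implybT.
have -> : (1 - l)^-1 `^ (p%:R / 2) = (1 - l) `^ (- (p%:R / 2)).
  by rewrite -powR_inv1 ?subr_ge0 ?ltW // -powRrM mulN1r.
by ring.
Qed.

(** The integral is improper at 0 for [r < 1]; it is the limit of the integrals
    over [[(i + 2)^-1, 1]]. *)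
Lemma integral_powR01_le (R : realType) (r : R) : 0 < r ->
  (\int[@lebesgue_measure R]_(l in `]0%R, 1%R[) (l `^ (r - 1))%:E <= (r^-1)%:E)%E.
Proof.
move=> r0.
pose F i : set R := `[i.+2%:R^-1, 1]%classic.
have mp D : measurable_fun D (fun l : R => (l `^ (r - 1))%:E).
  by apply/measurable_EFinP/measurable_funTS; exact: measurable_powR.
have FE i : (\int[@lebesgue_measure R]_(l in F i) (l `^ (r - 1))%:E <= (r^-1)%:E)%E.
  have e1 : i.+2%:R^-1 < 1 :> R by rewrite invf_lt1 // ltr1n.
  have e0 : 0 < i.+2%:R^-1 :> R by rewrite invr_gt0.
  have dP (x : R) : 0 < x -> is_derive x 1 (fun l => r^-1 * l `^ r) (x `^ (r - 1)).
    move=> x0; have dp := is_derive1_powR r x0.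
    by apply: is_derive_eq; rewrite /GRing.scale /=; field; rewrite gt_eqF.
  have cF (x : R) : 0 < x -> {for x, continuous (fun l => r^-1 * l `^ r)}.
    by move=> /dP[d _]; apply/differentiable_continuous/derivable1_diffP.
  have cf (x : R) : 0 < x -> {for x, continuous (fun l => l `^ (r - 1))}.
    move=> x0; apply/differentiable_continuous/derivable1_diffP.
    by have [] := is_derive1_powR (r - 1) x0.
  rewrite (@continuous_FTC2 _ _ (fun l => r^-1 * l `^ r)) //.
  - rewrite -EFinB lee_fin powR1 mulr1 lerBlDr lerDl.
    by rewrite mulr_ge0 ?powR_ge0 // invr_ge0 ltW.
  - apply: continuous_in_subspaceT => x; rewrite inE /= in_itv /= => /andP[ex _].
    by apply: cf; exact: lt_le_trans ex.
  - split.
    + move=> x; rewrite in_itv /= => /andP[ex _].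
      by have [] := dP x (lt_trans e0 ex).
    + by apply: cvg_at_right_filter; exact: cF.
    + by apply: cvg_at_left_filter; exact: cF.
  - move=> x; rewrite in_itv /= => /andP[ex _].
    by rewrite derive1E; have [_ ->] := dP x (lt_trans e0 ex).
have ndF : nondecreasing_seq F.
  move=> i j ij; apply/subsetPset => x; rewrite /F /= !in_itv /= => /andP[ix ->].
  by rewrite andbT (le_trans _ ix) // lef_pV2 ?posrE // ler_nat ltnS.
have cvg : (\int[@lebesgue_measure R]_(l in F i) (l `^ (r - 1))%:E @[i --> \oo] -->
    \int[@lebesgue_measure R]_(l in \bigcup_i F i) (l `^ (r - 1))%:E)%E.
  apply: ge0_nondecreasing_set_cvg_integral => //.
  - by move=> i; exact: measurable_itv.
  - by move=> i; exact: mp.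
  - by move=> i l _; rewrite lee_fin powR_ge0.
apply: (@le_trans _ _ (\int[@lebesgue_measure R]_(x in \bigcup_i F i) (x `^ (r - 1))%:E)%E).
  apply: ge0_subset_integral => //.
  - by apply: bigcup_measurable => i _; exact: measurable_itv.
  - exact: mp.
  - by move=> x _; rewrite lee_fin powR_ge0.
  - move=> x /=; rewrite in_itv /= => /andP[x0 x1].
    exists (Num.trunc x^-1) => //; rewrite /F /= in_itv /= (ltW x1) andbT.
    rewrite invf_ple ?posrE // ltW // (lt_le_trans (truncnS_gt _)) //.
    by rewrite ler_nat.
rewrite -(cvg_lim _ cvg) //; apply: lime_le; first by apply/cvg_ex; eexists; exact: cvg.
by apply: nearW => i; exact: FE.
Qed.

(** Half of the exponent [q = p / 2 + a + 1 > 0] is given up to dominate [L],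
    and the other half keeps the power integrable at 0. *)
Lemma laplace_mixing_lty (R : realType) (p : nat) (a C : R) (L : R -> R) (w : R) :
  0 < p%:R / 2 + a + 1 -> (forall y, 1 <= y -> 0 <= L y) ->
  differentiable_from 1 L ->
  (forall y, 1 < y -> L y <= C * y `^ ((p%:R / 2 + a + 1) / 2)) -> 0 <= w ->
  (laplace (mixing p a L) w < +oo)%E.
Proof.
set q := p%:R / 2 + a + 1 => q0 L0 L3 LC w0.
have mW := @measurable_mixing R p a L L3.
have C0 : 0 <= C.
  have pow0 : 0 < 2 `^ (q / 2) by rewrite powR_gt0.
  rewrite -(pmulr_lge0 C pow0); apply: (@le_trans _ _ (L 2)).
    by apply: L0; lra.
  by apply: LC; lra.
apply: (@le_lt_trans _ _ (\int[@lebesgue_measure R]_(l in `]0%R, 1%R[)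
    (C%:E * (l `^ (q / 2 - 1))%:E))%E); last first.
  rewrite ge0_integralZl_EFin //.
  - apply: (@le_lt_trans _ _ (C%:E * ((q / 2)^-1)%:E)%E); last by rewrite -EFinM ltry.
    by apply: lee_wpmul2l; [rewrite lee_fin|apply: integral_powR01_le; rewrite divr_gt0].
  - by move=> l _; rewrite lee_fin powR_ge0.
  - by apply/measurable_EFinP/measurable_funTS; exact: measurable_powR.
rewrite [leRHS]integral_mkcond /laplace; apply: ge0_le_integral => //.
- by move=> l _; rewrite lee_fin mulr_ge0 ?expR_ge0 ?mixing_ge0.
- apply/measurable_EFinP; apply: measurable_funM => //.
  apply: (measurableT_comp (@measurable_expR R)).
  by apply: measurableT_comp => //; apply: measurable_funM => //; apply: measurable_funM.
- apply/(measurable_restrictT _ _).1; first exact: measurable_itv.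
  apply: measurable_funeM; apply/measurable_EFinP/measurable_funTS.
  exact: (measurable_powR (q / 2 - 1)).
move=> l _; rewrite patchE /mixing.
have -> : (l \in `]0, 1[%classic) = (0 < l < 1) by rewrite mem_setE in_itv.
case: ifPn => [l01|_]; last by rewrite mul0r.
have /andP[l0 l1] := l01.
rewrite -EFinM lee_fin.
apply: (@le_trans _ _ (l `^ (p%:R / 2 + a) * L l^-1)).
  rewrite ler_piMr //; first by rewrite mulr_ge0 ?powR_ge0 // L0 // ltW // inv_gt1.
  by rewrite expR_le1 oppr_le0 divr_ge0 // mulr_ge0 // ltW.
apply: (@le_trans _ _ (l `^ (p%:R / 2 + a) * (C * l^-1 `^ (q / 2)))).
  by rewrite ler_wpM2l ?powR_ge0 // LC // inv_gt1.
rewrite mulrCA ler_wpM2l // -(powR_inv1 (ltW l0)) -powRrM -powRD; last first.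
  by rewrite (gt_eqF l0) implybT.
by rewrite le_eqVlt; apply/orP; left; apply/eqP; congr (_ `^ _); rewrite /q; field.
Qed.

(** * Comparison of Laplace transforms with a power weight *)

(** Antiderivative behind the gamma integral: it makes the mean of [w * l]
    under the weight [l `^ (r - 1) * expR (- (l * w / 2))] computable. *)
Lemma is_derive_powR_expR (R : realType) (r w x : R) : 0 < x ->
  is_derive x 1 (fun l => 2 * (l `^ r * expR (- (l * w / 2))))
    ((2 * r - w * x) * x `^ (r - 1) * expR (- (x * w / 2))).
Proof.
move=> x0; have dp := is_derive1_powR r x0.
have de : is_derive x 1 (fun l => expR (- (l * w / 2)))
    (expR (- (x * w / 2)) * - (w / 2)).
  apply: (@is_derive1_comp _ expR (fun l => - (l * w / 2))).
  by apply: is_derive_eq; rewrite /GRing.scale /=; field.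
have xr : x `^ r = x * x `^ (r - 1).
  rewrite -[X in X * _](powRr1 (ltW x0)) -powRD ?(gt_eqF x0) ?implybT //.
  by congr (_ `^ _); ring.
by apply: is_derive_eq; rewrite /GRing.scale /= xr; field.
Qed.

Lemma continuous_powR_expR (R : realType) (r w x : R) : 0 < x ->
  {for x, continuous
    (fun l => (2 * r - w * l) * l `^ (r - 1) * expR (- (l * w / 2)))}.
Proof.
move=> x0; have cp : {for x, continuous (fun l => l `^ (r - 1))}.
  apply/differentiable_continuous/derivable1_diffP.
  by have [] := is_derive1_powR (r - 1) x0.
apply: cvgM.
  apply: cvgM; last exact: cp.
  apply: cvgB; first exact: cvg_cst.
  by apply: cvgM; [exact: cvg_cst|exact: cvg_id].
apply: (cvg_comp _ expR); last exact: continuous_expR.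
apply: cvgN; apply: cvgM; last exact: cvg_cst.
by apply: cvgM; [exact: cvg_id|exact: cvg_cst].
Qed.

Lemma integral_powR_expR (R : realType) (r w A B : R) : 0 < A < B ->
  (\int[@lebesgue_measure R]_(l in `[A, B])
     ((2 * r - w * l) * l `^ (r - 1) * expR (- (l * w / 2)))%:E =
   (2 * (B `^ r * expR (- (B * w / 2))) - 2 * (A `^ r * expR (- (A * w / 2))))%:E)%E.
Proof.
move=> /andP[A0 AB].
pose F l := 2 * (l `^ r * expR (- (l * w / 2))).
have dF (x : R) : 0 < x -> is_derive x 1 F
    ((2 * r - w * x) * x `^ (r - 1) * expR (- (x * w / 2))).
  exact: is_derive_powR_expR.
have cF (x : R) : 0 < x -> {for x, continuous F}.
  by move=> /dF[d _]; apply/differentiable_continuous/derivable1_diffP.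
rewrite EFinB (@continuous_FTC2 _ _ F) //.
- apply: continuous_in_subspaceT => x; rewrite inE /= in_itv /= => /andP[ax _].
  by apply: continuous_powR_expR; exact: lt_le_trans ax.
- split.
  + move=> x; rewrite in_itv /= => /andP[ex _].
    by have [] := dF x (lt_trans A0 ex).
  + by apply: cvg_at_right_filter; exact: cF.
  + by apply: cvg_at_left_filter; apply: cF; exact: lt_trans AB.
- move=> x; rewrite in_itv /= => /andP[ex _].
  by rewrite derive1E; have [_ ->] := dF x (lt_trans A0 ex).
Qed.

Section laplace_ratio.
Context (R : realType) (W : R -> R).
Hypothesis mW : measurable_fun [set: R] W.
Hypothesis W0 : forall l : R, 0 <= W l.
Hypothesis Wout : forall l : R, ~~ (0 < l < 1) -> W l = 0.

Lemma measurable_laplace_integrand (w : R) :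
  measurable_fun [set: R] (fun l => W l * expR (- (l * w / 2))).
Proof.
apply: measurable_funM => //; apply: (measurableT_comp (@measurable_expR R)).
by apply: measurableT_comp => //; apply: measurable_funM => //; apply: measurable_funM.
Qed.

Lemma integrable_laplace (w : R) : (laplace W w < +oo)%E ->
  (@lebesgue_measure R).-integrable [set: R]
    (fun l => (W l * expR (- (l * w / 2)))%:E).
Proof.
move=> oo; apply/integrableP; split.
  by apply/measurable_EFinP; exact: measurable_laplace_integrand.
rewrite [ltLHS](_ : _ = laplace W w) //.
by apply: eq_integral => l _; rewrite /= ger0_norm // mulr_ge0 ?expR_ge0.
Qed.

Lemma le_laplace_id (w : R) : (laplace (fun l => (l * W l)%R) w <= laplace W w)%E.
Proof.
apply: ge0_le_integral => //.
- move=> l _; rewrite lee_fin; have [/andP[l0 _]|l01] := boolP (0 < l < 1).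
    by rewrite !mulr_ge0 ?expR_ge0 // ltW.
  by rewrite Wout // mulr0 mul0r.
- apply/measurable_EFinP; under eq_fun do rewrite -mulrA.
  by apply: measurable_funM => //; exact: measurable_laplace_integrand.
- by apply/measurable_EFinP; exact: measurable_laplace_integrand.
- move=> l _; rewrite lee_fin; have [/andP[l0 l1]|l01] := boolP (0 < l < 1).
    by rewrite ler_wpM2r ?expR_ge0 // ler_piMl // ltW.
  by rewrite Wout // mulr0 mul0r.
Qed.

(** The right-hand side is the integral of [(D - w * l) * W l * e l], where
    [e l = expR (- (l * w / 2))]. On [[A, B]], [W] is the power [l `^ (r - 1)]
    times the nonincreasing function [M]. The factor [D - w * l] changes sign at
    [D / w], from positive to negative, so that replacing [M l] by [M (D / w)]
    lowers the integrand. Write [D - w * l = (2 * r - w * l) + (D - 2 * r)]: the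
    first part has an explicit antiderivative, which yields the boundary term
    [2 * A `^ r], and the second part is nonnegative and is kept only on
    [[w^-1, 2 / w]], where [e] is at least [expR (- 1)]. Below [A] the integrand
    is nonnegative, and above [B] it is exponentially small. *)
Lemma laplace_ratio_ge (M : R -> R) (w A B C D r J0 J1 : R) :
  laplace W w = J0%:E -> laplace (fun l => l * W l) w = J1%:E ->
  0 < w -> 0 < r -> A <= w^-1 -> 0 < A -> 2 / w <= B -> B < 1 -> 0 <= C ->
  A <= D / w <= B -> 2 * r <= D ->
  (forall l, A <= l <= B -> W l = l `^ (r - 1) * M l) ->
  (forall l l', A <= l -> l <= l' -> l' <= B -> M l' <= M l) ->
  0 <= M B ->
  (forall l, B < l < 1 -> l * W l <= C) ->
  M (D / w) * ((D - 2 * r) / (2 * expR 1) * w `^ (- r) - 2 * A `^ r)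
    - C * w * expR (- (B * w / 2)) <= D * J0 - w * J1.
Proof.
move=> E0 E1 w0 r0 Aw A0 wB B1 C0 /andP[AD DB] rD WM Mmono MB0 WC.
set Ms := M (D / w).
have Ms0 : 0 <= Ms by apply: (le_trans MB0); exact: Mmono.
have wV0 : 0 < w^-1 by rewrite invr_gt0.
have AB : A < B by lra.
pose e l := expR (- (l * w / 2)).
have e0 l : 0 <= e l by exact: expR_ge0.
pose k := (D - 2 * r) / (2 * expR 1) * w `^ (1 - r).
have k0 : 0 <= k.
  by rewrite mulr_ge0 ?powR_ge0 // divr_ge0 ?subr_ge0 // mulr_ge0 ?expR_ge0.
pose g1 l := (2 * r - w * l) * l `^ (r - 1) * e l.
pose c3 := C * w * e B.
(* The integrable minorant [g] of [f]: its three terms come from the gamma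
   antiderivative, from the surplus [D - 2 * r], and from the tail above [B]. *)
pose g l := Ms * (g1 \_ `[A, B]) l + Ms * k * \1_`[w^-1, 2 / w] l
   - c3 * \1_`]0, 1[ l.
pose f l := D * (W l * e l) - w * (l * W l * e l).
have fg l : g l <= f l.
  rewrite /g /f !indicE !mem_setE patchE mem_setE !in_itv /=.
  rewrite (_ : point = 0 :> R) //.
  have D0 : 0 <= D by lra.
  have [l01|l01] := boolP (0 < l < 1); last first.
    have -> : (A <= l <= B) = false.
      by apply: contraNF l01 => /andP[? ?]; apply/andP; split; lra.
    have -> : (w^-1 <= l <= 2 / w) = false.
      by apply: contraNF l01 => /andP[? ?]; apply/andP; split; lra.
    by rewrite Wout //= mulr0n; lra.
  have /andP[l0 l1] := l01.
  have c30 : 0 <= c3 by rewrite !mulr_ge0 // ltW.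
  have [lA|Al] := ltP l A.
    have -> : (w^-1 <= l <= 2 / w) = false.
      by apply/negbTE; rewrite negb_and -ltNge (lt_le_trans lA).
    rewrite /= mulr0n mulr1n !mulr0 !add0r mulr1.
    have : 0 <= (D - w * l) * (W l * e l).
      rewrite mulr_ge0 ?mulr_ge0 // subr_ge0 -ler_pdivlMl // mulrC.
      by rewrite (le_trans (ltW lA)).
    by move=> ?; rewrite -mulrA; lra.
  have [Bl|lB] := ltP B l.
    have -> : (w^-1 <= l <= 2 / w) = false.
      by apply/negbTE; rewrite negb_and -!ltNge (le_lt_trans wB) ?orbT.
    rewrite /= mulr0n mulr1n !mulr0 !add0r mulr1.
    have : w * (l * W l * e l) <= c3.
      have -> : c3 = w * (C * e B) by rewrite /c3; ring.
      rewrite ler_wpM2l ?(ltW w0) //.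
      rewrite ler_pM ?mulr_ge0 ?(ltW l0) // ?WC ?Bl //.
      by rewrite ler_expR lerN2 ler_pM2r // ler_pM2r // ltW.
    have : 0 <= D * (W l * e l) by rewrite !mulr_ge0.
    by lra.
  rewrite /= mulr1n mulr1 WM ?Al //; set y := l `^ (r - 1).
  have y0 : 0 <= y by exact: powR_ge0.
  have sgn : (D - w * l) * Ms <= (D - w * l) * M l.
    have [lD|Dl] := leP l (D / w).
      rewrite ler_wpM2l ?Mmono //.
      by rewrite subr_ge0 -ler_pdivlMl // mulrC.
    apply: ler_wnM2l; last by apply: Mmono => //; exact: ltW.
    by rewrite subr_le0 -ler_pdivrMl // mulrC ltW.
  have ind : Ms * k * (w^-1 <= l <= 2 / w)%R%:R <= Ms * ((D - 2 * r) * y * e l).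
    rewrite -mulrA ler_wpM2l //.
    have [/andP[wl l2]|_] := boolP (w^-1 <= l <= 2 / w); last first.
      by rewrite mulr0 !mulr_ge0 // subr_ge0.
    have P1 : w `^ (1 - r) / 2 <= y.
      have -> : w `^ (1 - r) = w * w^-1 `^ r.
        rewrite -(powR_inv1 (ltW w0)) -powRrM mulN1r.
        by rewrite -[X in X * _](powRr1 (ltW w0)) -powRD // (gt_eqF w0) implybT.
      have -> : y = l^-1 * l `^ r.
        rewrite /y -(powR_inv1 (ltW l0)) -powRD ?(gt_eqF l0) ?implybT //.
        by congr (_ `^ _); ring.
      rewrite mulrAC; apply: ler_pM; rewrite ?powR_ge0 //.
      - by rewrite divr_ge0 // ltW.
      - by rewrite -[leLHS]invrK lef_pV2 ?posrE ?invr_gt0 ?divr_gt0 // invf_div.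
      - by apply: ge0_ler_powR; rewrite ?nnegrE // ltW.
    have P2 : (expR 1)^-1 <= e l.
      by rewrite -expRN ler_expR lerN2 ler_pdivrMr // mul1r -ler_pdivlMr.
    rewrite mulr1 /k -[leRHS]mulrA.
    rewrite [leLHS](_ : _ = (D - 2 * r) * (w `^ (1 - r) / 2 * (expR 1)^-1)).
      by rewrite ler_wpM2l ?subr_ge0 // ler_pM // ?invr_ge0 ?expR_ge0 // divr_ge0 ?powR_ge0.
    by rewrite invfM; ring.
  have := ler_wpM2r (mulr_ge0 y0 (e0 l)) sgn.
  by rewrite /g1 -/y; lra.
have if0 : (@lebesgue_measure R).-integrable [set: R] (fun l => (W l * e l)%:E).
  by apply: integrable_laplace; rewrite E0 ltry.
have if1 : (@lebesgue_measure R).-integrable [set: R] (fun l => (l * W l * e l)%:E).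
  apply: (le_integrable _ _ _ if0) => //.
    apply/measurable_EFinP; under eq_fun do rewrite -mulrA.
    by apply: measurable_funM => //; exact: measurable_laplace_integrand.
  move=> l _; change ((`|l * W l * e l|)%:E <= (`|W l * e l|)%:E)%E.
  rewrite lee_fin -mulrA normrM.
  have [/andP[l0 l1]|l01] := boolP (0 < l < 1).
    by rewrite ler_piMl // ger0_norm // ltW.
  by rewrite Wout // mul0r normr0 mulr0.
have if2 : (@lebesgue_measure R).-integrable [set: R] (EFin \o (g1 \_ `[A, B])).
  rewrite -restrict_EFin; apply/(integrable_mkcond _ _).1 => //.
  apply: continuous_compact_integrable; first exact: segment_compact.
  apply: continuous_in_subspaceT => x; rewrite inE /= in_itv /= => /andP[ax _].
  by apply: continuous_powR_expR; exact: lt_le_trans ax.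
have iZ (c : R) (h : R -> R) :
    (@lebesgue_measure R).-integrable [set: R] (EFin \o h) ->
    (@lebesgue_measure R).-integrable [set: R] (EFin \o (fun l => c * h l)).
  by move=> ih; exact: (integrableZl measurableT c ih).
have iD (h1 h2 : R -> R) :
    (@lebesgue_measure R).-integrable [set: R] (EFin \o h1) ->
    (@lebesgue_measure R).-integrable [set: R] (EFin \o h2) ->
    (@lebesgue_measure R).-integrable [set: R] (EFin \o (fun l => h1 l + h2 l)).
  by move=> ih1 ih2; exact: (integrableD measurableT ih1 ih2).
have iB (h1 h2 : R -> R) :
    (@lebesgue_measure R).-integrable [set: R] (EFin \o h1) ->
    (@lebesgue_measure R).-integrable [set: R] (EFin \o h2) ->
    (@lebesgue_measure R).-integrable [set: R] (EFin \o (fun l => h1 l - h2 l)).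
  by move=> ih1 ih2; exact: (integrableB measurableT ih1 ih2).
have iI (a b : R) (b0 b1 : bool) : (@lebesgue_measure R).-integrable [set: R]
    (EFin \o \1_[set` Interval (BSide b0 a) (BSide b1 b)]).
  exact: integrable_indic_itv.
have RI (a b : R) (b0 b1 : bool) : a <= b -> (\int[@lebesgue_measure R]_l
    (\1_[set` Interval (BSide b0 a) (BSide b1 b)] l : R) = b - a)%R.
  move=> ab; rewrite /Rintegral integral_indic //= setIT lebesgue_measure_itv /=.
  rewrite lte_fin; case: ltP => [_|ba]; first by rewrite -EFinB.
  by rewrite (@le_anti _ _ a b) ?subrr // ab ba.
have w2 : w^-1 <= 2 / w by lra.
have ig : (@lebesgue_measure R).-integrable [set: R] (EFin \o g).
  by apply: iB; [apply: iD; apply: iZ|apply: iZ].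
have if_ : (@lebesgue_measure R).-integrable [set: R] (EFin \o f).
  by apply: iB; apply: iZ.
have If : (\int[@lebesgue_measure R]_l f l = D * J0 - w * J1)%R.
  rewrite /f RintegralB //; [|exact: iZ|exact: iZ].
  by rewrite !RintegralZl // /Rintegral -[J0]/(fine J0%:E) -[J1]/(fine J1%:E) -E0 -E1.
have Ig : (\int[@lebesgue_measure R]_l g l =
    Ms * (2 * (B `^ r * e B) - 2 * (A `^ r * e A)) + Ms * k * w^-1 - c3)%R.
  rewrite /g RintegralB //; [|by apply: iD; exact: iZ|exact: iZ].
  rewrite RintegralD //; [|exact: iZ|exact: iZ].
  rewrite !RintegralZl // !RI // ?subr0 ?mulr1.
  rewrite (_ : 2 / w - w^-1 = w^-1); last by field; rewrite gt_eqF.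
  congr (_ * _ + _ - _); rewrite -Rintegral_mkcond /Rintegral.
  by rewrite integral_powR_expR // A0.
have : (\int[@lebesgue_measure R]_l g l <= \int[@lebesgue_measure R]_l f l)%R.
  by apply: le_Rintegral => // l _; exact: fg.
rewrite If Ig; apply: le_trans; rewrite lerD2r.
rewrite [leRHS](_ : _ = Ms * (k * w^-1 + 2 * (B `^ r * e B) - 2 * (A `^ r * e A)));
  last by ring.
apply: ler_wpM2l => //.
have -> : k * w^-1 = (D - 2 * r) / (2 * expR 1) * w `^ (- r).
  rewrite /k -mulrA; congr (_ * _).
  rewrite -(powR_inv1 (ltW w0)) -powRD ?(gt_eqF w0) ?implybT //.
  by congr (_ `^ _); ring.
have : A `^ r * e A <= A `^ r.
  rewrite ler_piMr ?powR_ge0 // expR_le1 oppr_le0 divr_ge0 // mulr_ge0 //; exact: ltW.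
have : 0 <= B `^ r * e B by rewrite mulr_ge0 ?powR_ge0.
lra.
Qed.

End laplace_ratio.

(** * The deficit of the shrinkage factor below p - 2 *)

Lemma ln_powRN_small (R : realType) (t e : R) : 0 < t -> 0 < e ->
  \forall w \near +oo, ln w * w `^ (- t) <= e.
Proof.
move=> t0 e0; have t20 : 0 < t / 2 by lra.
pose c := (t / 2 * e)^-1.
have c0 : 0 < c by rewrite invr_gt0 mulr_gt0.
near=> w.
have w1 : 1 < w by near: w; apply: nbhs_pinfty_gt; rewrite num_real.
have wc : c `^ (t / 2)^-1 <= w by near: w; apply: nbhs_pinfty_ge; rewrite num_real.
have w0 : 0 < w by lra.
have P0 : 0 < w `^ (t / 2) by rewrite powR_gt0.
have cP : c <= w `^ (t / 2).
  have -> : c = (c `^ (t / 2)^-1) `^ (t / 2).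
    by rewrite -powRrM mulVf ?gt_eqF // powRr1 // ltW.
  by apply: ge0_ler_powR; rewrite ?nnegrE ?powR_ge0 // ltW.
have lnP : t / 2 * ln w <= w `^ (t / 2).
  by rewrite -ln_powR ltW // ln_sublinear.
have -> : w `^ (- t) = (w `^ (t / 2))^-1 * (w `^ (t / 2))^-1.
  by rewrite -powRN -powRD ?(gt_eqF w0) ?implybT //; congr (_ `^ _); field.
rewrite mulrA ler_pdivrMr // ler_pdivrMr //.
have : 1 <= t / 2 * e * w `^ (t / 2).
  by rewrite -ler_pdivrMl ?mulr_gt0 // mulr1.
move: lnP P0; set P := w `^ _ => lnP P0 eP.
rewrite -(ler_pM2l t20); apply: (le_trans lnP).
have -> : t / 2 * (e * P * P) = (t / 2 * e * P) * P by ring.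
by rewrite ler_peMl // ltW.
Unshelve. all: by end_near. Qed.

Lemma powR_expR_small (R : realType) (s b e : R) : 0 < b -> 0 < e ->
  \forall w \near +oo, ln w * (w `^ s * expR (- (b * w))) <= e.
Proof.
move=> b0 e0; pose n := (Num.trunc (s + 1)).+1.
have sn : s + 1 <= n%:R by rewrite ltW // truncnS_gt.
pose K := n.+1`!%:R / b ^+ n.+1.
near=> w.
have w1 : 1 < w by near: w; apply: nbhs_pinfty_gt; rewrite num_real.
have wK : K / e <= w by near: w; apply: nbhs_pinfty_ge; rewrite num_real.
have w0 : 0 < w by lra.
have lnw : ln w <= w by rewrite ltW // ln_sublinear.
have ws : w * w `^ s <= w ^+ n.
  rewrite -powR_mulrn ?(ltW w0) // -[X in X * _](powRr1 (ltW w0)).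
  rewrite -powRD ?(gt_eqF w0) ?implybT //.
  by apply: ler_powR; [exact: ltW|rewrite addrC].
have ebw : w ^+ n.+1 / K <= expR (b * w).
  have bw0 : 0 <= b * w by rewrite mulr_ge0 // ltW.
  apply: le_trans (expR_ge1Dxn n bw0).
  rewrite /K invfM invrK exprMn; lra.
rewrite expRN; set E := expR (b * w) in ebw *.
have E0 : 0 < E by exact: expR_gt0.
rewrite mulrA ler_pdivrMr //.
apply: (@le_trans _ _ (w ^+ n)).
  by apply: le_trans ws; rewrite ler_wpM2r ?powR_ge0.
have K0 : 0 < K by rewrite divr_gt0 ?exprn_gt0 // ltr0n fact_gt0.
apply: (@le_trans _ _ (e * (w ^+ n.+1 / K))); last by rewrite ler_pM2l.
have -> : e * (w ^+ n.+1 / K) = w ^+ n * (e * w / K) by rewrite exprS; ring.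
rewrite -[leLHS]mulr1 ler_wpM2l ?exprn_ge0 ?(ltW w0) //.
by rewrite ler_pdivlMr // mul1r mulrC -ler_pdivrMr.
Unshelve. all: by end_near. Qed.

(** The surplus [k / ln w] of the comparison beats both error terms, uniformly in
    the exponent [r]: the boundary term is smaller by the factor
    [w `^ (- (eta * r))], and the tail by an exponential. *)
Lemma eventually_gap (R : realType) (eta r1 r2 b k K : R) :
  0 < eta -> 0 < r1 -> 0 < b -> 0 < k -> 0 <= K ->
  \forall w \near +oo, forall r, r1 <= r <= r2 ->
    K * w * expR (- (b * w)) <=
    k / ln w * w `^ (- r) - 2 * (w `^ (- (1 + eta))) `^ r.
Proof.
move=> eta0 r10 b0 k0 K0.
have t0 : 0 < eta * r1 by exact: mulr_gt0.
have k40 : 0 < k / 4 by lra.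
have kK : 0 < k / 2 / (K + 1) by rewrite !divr_gt0 //; lra.
near=> w => r /andP[r1r rr2].
have w1 : 1 < w by near: w; apply: nbhs_pinfty_gt; rewrite num_real.
have H1 : ln w * w `^ (- (eta * r1)) <= k / 4.
  by near: w; exact: ln_powRN_small.
have H2 : ln w * (w `^ (1 + r2) * expR (- (b * w))) <= k / 2 / (K + 1).
  by near: w; exact: powR_expR_small.
have w0 : 0 < w by lra.
have lnw : 0 < ln w by rewrite ln_gt0.
have wN0 : w != 0 by rewrite gt_eqF.
have -> : (w `^ (- (1 + eta))) `^ r = w `^ (- r) * w `^ (- (eta * r)).
  by rewrite -powRrM -powRD ?wN0 ?implybT //; congr (_ `^ _); ring.
have -> : K * w * expR (- (b * w)) =
    w `^ (- r) * (K * (w `^ (1 + r) * expR (- (b * w)))).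
  have -> : w `^ (1 + r) = w * w `^ r.
    by rewrite powRD ?wN0 ?implybT // powRr1 // ltW.
  have pr : w `^ (- r) * w `^ r = 1.
    by rewrite -powRD ?wN0 ?implybT // addNr powRr0.
  by rewrite -[LHS]mul1r -pr; ring.
have -> : k / ln w * w `^ (- r) - 2 * (w `^ (- r) * w `^ (- (eta * r))) =
    w `^ (- r) * (k / ln w - 2 * w `^ (- (eta * r))) by ring.
rewrite ler_wpM2l ?powR_ge0 // -(ler_pM2l lnw).
have -> : ln w * (k / ln w - 2 * w `^ (- (eta * r))) =
    k - 2 * (ln w * w `^ (- (eta * r))) by field; rewrite gt_eqF.
have A1 : ln w * w `^ (- (eta * r)) <= ln w * w `^ (- (eta * r1)).
  rewrite ler_wpM2l ?(ltW lnw) // ler_powR ?(ltW w1) //.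
  by rewrite lerN2 ler_pM2l.
have A2 : ln w * (w `^ (1 + r) * expR (- (b * w))) <=
    ln w * (w `^ (1 + r2) * expR (- (b * w))).
  rewrite ler_wpM2l ?(ltW lnw) // ler_wpM2r ?expR_ge0 // ler_powR ?(ltW w1) //.
  by rewrite lerD2l.
have A3 : ln w * (K * (w `^ (1 + r) * expR (- (b * w)))) <= k / 2.
  rewrite mulrCA; apply: (@le_trans _ _ (K * (k / 2 / (K + 1)))).
    by rewrite ler_wpM2l // (le_trans A2).
  by rewrite mulrCA ler_piMr ?ler_pdivrMr ?mul1r; lra.
lra.
Unshelve. all: by end_near. Qed.

Section deficit.
Context (R : realType) (p : nat) (a : R) (L : R -> R).
Hypothesis L_ge0 : forall y, 1 <= y -> 0 <= L y.
Hypothesis L1 : slowly_varying L.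
Hypothesis L3 : differentiable_from 1 L.
Hypothesis L'_mono : ultimately_monotone L^`()%classic.
Hypothesis q_gt0 : 0 < p%:R / 2 + a + 1.

Let q := p%:R / 2 + a + 1.
Let W := mixing p a L.

Lemma mixing_bounded : exists C, 0 <= C /\ forall l, 0 < l < 1 -> l * W l <= C.
Proof.
have q20 : 0 < q / 2 by rewrite divr_gt0.
have [C [C0 HC]] := slowly_varying_le_powR L_ge0 L1 L3 L'_mono q20.
exists C; split; first exact: ltW.
move=> l l01; rewrite /W /mixing l01; have /andP[l0 l1] := l01.
have lN0 : l != 0 by rewrite gt_eqF.
have -> : l * (l `^ (p%:R / 2 + a) * L l^-1) = l `^ q * L l^-1.
  by rewrite mulrA -[X in X * _ * _](powRr1 (ltW l0)) -powRD ?lN0 ?implybT //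
    [1 + _]addrC.
apply: (@le_trans _ _ (l `^ q * (C * l^-1 `^ (q / 2)))).
  by rewrite ler_wpM2l ?powR_ge0 // HC // inv_gt1.
rewrite -(powR_inv1 (ltW l0)) -powRrM mulrCA ler_piMr ?(ltW C0) //.
rewrite -powRD ?lN0 ?implybT //.
have -> : q + -1 * (q / 2) = q / 2 by field.
apply: (@le_trans _ _ (1 `^ (q / 2))); last by rewrite powR1.
by apply: ge0_ler_powR; rewrite ?nnegrE // ltW.
Qed.

(** As far as the Laplace transform at [w] can see, [L] grows at least like the
    power [s w], which may depend on [w]: the monotonicity is needed only up to
    [w `^ (1 + eta)]. Hence [W] is compared with the power weight of exponent
    [q - s w - 1], for which the quotient is [2 * (q - s w) / w], and the
    surplus [kap / ln w] absorbs the errors of the comparison. *)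
Lemma laplace_ratio_deficit (eta bp kap r1 r2 Y m0 : R) (s : R -> R) :
  0 < eta -> 0 < bp -> 0 < kap -> 0 < r1 -> 1 < Y -> 0 < m0 ->
  (\forall w \near +oo,
    [/\ r1 <= q - s w <= r2,
        2 * (q - s w) + kap / ln w <= p%:R - 2 - 2 * bp / ln w,
        forall x y, Y <= x -> x <= y -> y <= w `^ (1 + eta) ->
          L x * x `^ (- s w) <= L y * y `^ (- s w)
      & m0 <= L Y * Y `^ (- s w)]) ->
  \forall w \near +oo, forall J0 J1,
    laplace W w = J0%:E -> laplace (fun l => l * W l) w = J1%:E ->
    w * J1 <= (p%:R - 2 - 2 * bp / ln w) * J0.
Proof.
move=> eta0 bp0 kap0 r10 Y1 m00 H.
have [C [C0 HC]] := mixing_bounded.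
have Y0 : 0 < Y by lra.
pose B := Y^-1; have B0 : 0 < B by rewrite invr_gt0.
have B20 : 0 < B / 2 by lra.
have k0 : 0 < kap / (2 * expR 1) by rewrite divr_gt0 // mulr_gt0 ?expR_gt0.
have K0 : 0 <= C / m0 by rewrite divr_ge0 // ltW.
have r120 : 0 < 2 * r1 by lra.
near=> w => J0 J1 E0 E1.
have [/andP[rr1 rr2] Hr Hmono Hm0] : [/\ r1 <= q - s w <= r2,
        2 * (q - s w) + kap / ln w <= p%:R - 2 - 2 * bp / ln w,
        forall x y, Y <= x -> x <= y -> y <= w `^ (1 + eta) ->
          L x * x `^ (- s w) <= L y * y `^ (- s w)
      & m0 <= L Y * Y `^ (- s w)] by near: w.
have we : expR 1 <= w by near: w; apply: nbhs_pinfty_ge; rewrite num_real.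
have w2Y : 2 * Y <= w by near: w; apply: nbhs_pinfty_ge; rewrite num_real.
have wNY : p%:R * Y <= w by near: w; apply: nbhs_pinfty_ge; rewrite num_real.
have gap : forall r, r1 <= r <= r2 ->
    C / m0 * w * expR (- (B / 2 * w)) <=
    kap / (2 * expR 1) / ln w * w `^ (- r) - 2 * (w `^ (- (1 + eta))) `^ r.
  by near: w; apply: eventually_gap.
have small : ln w * w `^ (- eta) <= 2 * r1.
  by near: w; exact: ln_powRN_small.
have w1 : 1 < w by lra.
have w0 : 0 < w by lra.
have wN0 : w != 0 by rewrite gt_eqF.
have lnw1 : 1 <= ln w.
  by rewrite -(expRK 1) ler_ln // posrE expR_gt0.
have lnw0 : 0 < ln w by lra.
set r := q - s w in rr1 rr2 Hr *.
set D := p%:R - 2 - 2 * bp / ln w in Hr *.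
have klnw : 0 < kap / ln w by rewrite divr_gt0.
have blnw : 0 < 2 * bp / ln w by rewrite divr_gt0 // mulr_gt0.
have D2r : 2 * r <= D by lra.
have Dp : D <= p%:R by rewrite /D; lra.
pose A := w `^ (- (1 + eta)).
have A0 : 0 < A by rewrite powR_gt0.
have AE : A = w^-1 * w `^ (- eta).
  by rewrite /A opprD powRD ?wN0 ?implybT // powR_inv1 // ltW.
have weta1 : w `^ (- eta) <= 1.
  by rewrite -(powRr0 w) ler_powR // ?(ltW w1) // oppr_le0 ltW.
have wetar : w `^ (- eta) <= 2 * r1.
  by apply: le_trans small; rewrite ler_peMl ?powR_ge0.
have wV0 : 0 < w^-1 by rewrite invr_gt0.
have Aw : A <= w^-1 by rewrite AE ler_piMr // ltW.
have AD : A <= D / w.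
  by rewrite AE mulrC ler_wpM2r ?(ltW wV0) //; lra.
have DB : D / w <= B.
  by rewrite ler_pdivrMr // /B mulrC ler_pdivlMr // (le_trans _ wNY) // ler_wpM2r // ltW.
have wB : 2 / w <= B.
  by rewrite ler_pdivrMr // /B mulrC ler_pdivlMr.
have B1 : B < 1 by rewrite invf_lt1.
pose M l := L l^-1 * l^-1 `^ (- s w).
have AV : A^-1 = w `^ (1 + eta) by rewrite /A powRN invrK.
have Mmono l l' : A <= l -> l <= l' -> l' <= B -> M l' <= M l.
  move=> Al ll' l'B; have l0 : 0 < l by lra. have l'0 : 0 < l' by lra.
  apply: Hmono.
  - by rewrite -[Y]invrK lef_pV2 ?posrE.
  - by rewrite lef_pV2 ?posrE.
  - by rewrite -AV lef_pV2 ?posrE.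
have MB : M B = L Y * Y `^ (- s w) by rewrite /M /B invrK.
have MD : m0 <= M (D / w).
  by apply: (le_trans Hm0); rewrite -MB; exact: Mmono.
have WM l : A <= l <= B -> W l = l `^ (r - 1) * M l.
  move=> /andP[Al lB]; have l0 : 0 < l by lra.
  have l01 : 0 < l < 1 by rewrite l0; lra.
  rewrite /W /mixing l01 /M [RHS]mulrCA [LHS]mulrC; congr (_ * _).
  rewrite -(powR_inv1 (ltW l0)) -powRrM -powRD ?(gt_eqF l0) ?implybT //.
  by congr (_ `^ _); rewrite /r /q; ring.
have WC l : B < l < 1 -> l * W l <= C.
  by move=> /andP[Bl l1]; apply: HC; rewrite l1 andbT; lra.
have := @laplace_ratio_ge R W (measurable_mixing p a L3) (fun l => mixing_ge0 p a l L_ge0)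
  (fun l => @mixing_out R p a L l) M w A B C D r J0 J1 E0 E1 w0.
move=> /(_ _ Aw A0 wB B1 C0) E.
have {E} E := E (lt_le_trans r10 rr1).
have {E} := E _ D2r WM Mmono _ WC.
rewrite AD DB MB => /(_ isT) /(_ (le_trans (ltW m00) Hm0)).
set g := (_ * w `^ (- r) - _) => E.
have gE : C / m0 * w * expR (- (B / 2 * w)) <= g.
  apply: (le_trans (gap r _)); first by rewrite rr1 rr2.
  rewrite /g lerD2r ler_wpM2r ?powR_ge0 // mulrAC ler_wpM2r //.
  by lra.
have g0 : 0 <= g.
  by apply: le_trans gE; rewrite mulr_ge0 ?expR_ge0 // mulr_ge0 // ltW.
have : C * w * expR (- (B * w / 2)) <= M (D / w) * g.
  apply: (@le_trans _ _ (m0 * g)); last by rewrite ler_wpM2r.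
  apply: le_trans (ler_wpM2l (ltW m00) gE).
  rewrite le_eqVlt; apply/orP; left; apply/eqP.
  have -> : B / 2 * w = B * w / 2 by ring.
  by field; rewrite gt_eqF.
lra.
Unshelve. all: by end_near. Qed.

(** Here [s] is the negative constant [(a + 2) / 2]: half of the gap between
    [2 * q] and [p - 2] is given up to make [L y * y `^ (- s)] monotone. Since
    the other half is a constant, it exceeds any multiple of [1 / ln w], and the
    value 2 of [bp] is an arbitrary one above 1. *)
Lemma mixing_deficit_lt : a < - 2 ->
  exists bp, 1 < bp /\ \forall w \near +oo, forall J0 J1,
    laplace W w = J0%:E -> laplace (fun l => l * W l) w = J1%:E ->
    w * J1 <= (p%:R - 2 - 2 * bp / ln w) * J0.
Proof.
move=> a2; pose d := - (a + 2); have d0 : 0 < d by rewrite /d; lra.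
have d20 : 0 < d / 2 by lra.
have [Y [Y1 LY Hmono]] : exists Y, [/\ 1 < Y, 0 < L Y &
    forall x y, Y <= x -> x <= y -> L x * x `^ (d / 2) <= L y * y `^ (d / 2)].
  near (@pinfty_nbhs R) => Y; exists Y; split.
  - by near: Y; apply: nbhs_pinfty_gt; rewrite num_real.
  - by near: Y; exact: slowly_varying_gt0.
  - have : forall x y, Y <= x -> x <= y -> L x * x `^ (d / 2) <= L y * y `^ (d / 2) /\
        L y * y `^ (- (d / 2)) <= L x * x `^ (- (d / 2)).
      by near: Y; apply: slowly_varying_powR_mono.
    by move=> H x y Yx xy; case: (H x y Yx xy).
exists 2; split; first by lra.
have q0 : 0 < q by [].
apply: (@laplace_ratio_deficit 1 2 1 (q + d / 2) (q + d / 2) Y (L Y * Y `^ (d / 2))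
  (fun=> - (d / 2))) => //; first by lra.
  by rewrite mulr_gt0 // powR_gt0; lra.
near=> w.
have wd : expR (5 / d) <= w by near: w; apply: nbhs_pinfty_ge; rewrite num_real.
have w0 : 0 < w by apply: lt_le_trans wd; exact: expR_gt0.
have lnw : 5 / d <= ln w by rewrite -(expRK (5 / d)) ler_ln // posrE expR_gt0.
have lnw0 : 0 < ln w by apply: lt_le_trans lnw; rewrite divr_gt0.
rewrite opprK; split => //; first by rewrite lexx.
- have : 5 / ln w <= d.
    by rewrite ler_pdivrMr // mulrC -ler_pdivrMr.
  rewrite /q /d; lra.
- by move=> x y Yx xy _; exact: Hmono.
Unshelve. all: by end_near. Qed.

(** Here [s = c / ln w] with [1 < c < b]. The function
    [y |-> ln y `^ b * y `^ (- s)] increases as long as [s * ln y <= b], that is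
    up to [w `^ (b / c)], and [L] grows at least as fast as [ln y `^ b]. *)
Lemma mixing_deficit_log (b : R) : a = - 2 -> 1 < b ->
  ultimately_nonincreasing (fun y => ln y `^ b / L y) ->
  exists bp, 1 < bp /\ \forall w \near +oo, forall J0 J1,
    laplace W w = J0%:E -> laplace (fun l => l * W l) w = J1%:E ->
    w * J1 <= (p%:R - 2 - 2 * bp / ln w) * J0.
Proof.
move=> a2 b1 [y0 Hb].
(* With [eta = (b - 1) / 2], the exponent [b / c] equals [1 + eta]. *)
pose c := 2 * b / (1 + b).
have b0 : 0 < b by lra.
have c1 : 1 < c by rewrite /c ltr_pdivlMr; lra.
have cb : c * ((1 + b) / 2) = b by rewrite /c; field; lra.
have [Y [Y1 LY Yy0]] : exists Y, [/\ 1 < Y, forall y, Y <= y -> 0 < L y & y0 <= Y].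
  have [M [_ HM]] := slowly_varying_gt0 L_ge0 L1.
  near (@pinfty_nbhs R) => Y; exists Y; split.
  - by near: Y; apply: nbhs_pinfty_gt; rewrite num_real.
  - move=> y Yy; apply: HM; apply: lt_le_trans Yy.
    by near: Y; apply: nbhs_pinfty_gt; rewrite num_real.
  - by near: Y; apply: nbhs_pinfty_ge; rewrite num_real.
have q0 : 0 < q by [].
have pq : p%:R - 2 = 2 * q by rewrite /q a2; field.
have Y0 : 0 < Y by lra.
(* The power weight yields the deficit [2 * c / ln w], of which [(c - 1) / ln w]
   is spent on the errors. *)
exists ((1 + c) / 2); split; first by lra.
apply: (@laplace_ratio_deficit ((b - 1) / 2) _ (c - 1) (q / 2) q Y (L Y * Y `^ (- 1))
  (fun w => c / ln w)) => //; try lra.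
  by rewrite mulr_gt0 ?powR_gt0 // LY.
near=> w.
have wq : expR (2 * c / q) <= w by near: w; apply: nbhs_pinfty_ge; rewrite num_real.
have wc : expR c <= w by near: w; apply: nbhs_pinfty_ge; rewrite num_real.
have w0 : 0 < w by apply: lt_le_trans wc; exact: expR_gt0.
have lnq : 2 * c / q <= ln w by rewrite -(expRK (2 * c / q)) ler_ln // posrE expR_gt0.
have lnc : c <= ln w by rewrite -(expRK c) ler_ln // posrE expR_gt0.
have lnw0 : 0 < ln w by lra.
have sq : c / ln w <= q / 2.
  rewrite ler_pdivrMr // mulrC -ler_pdivrMr; last by lra.
  by rewrite invfM invrK mulrA mulrAC [c * 2]mulrC.
have s0 : 0 < c / ln w by rewrite divr_gt0 //; lra.
have s1 : c / ln w <= 1 by rewrite ler_pdivrMr // mul1r.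
split.
- by apply/andP; split; lra.
- rewrite pq -[leRHS]/(2 * q - 2 * ((1 + c) / 2) / ln w).
  have -> : (c - 1) / ln w = c / ln w - (ln w)^-1 by rewrite mulrBl mul1r.
  have -> : 2 * ((1 + c) / 2) / ln w = (ln w)^-1 + c / ln w by field; rewrite gt_eqF.
  lra.
- move=> x y Yx xy yw; have x1 : 1 < x by lra. have y1 : 1 < y by lra.
  have x0 : 0 < x by lra. have y00 : 0 < y by lra.
  have X0 : 0 < ln x by rewrite ln_gt0. have T0 : 0 < ln y by rewrite ln_gt0.
  have XT : ln x <= ln y by rewrite ler_ln.
  have Lx := LY x Yx. have Ly := LY y (le_trans Yx xy).
  have Hxy : L x * ln y `^ b <= L y * ln x `^ b.
    have := Hb y x; rewrite !in_itv /= !andbT (le_trans Yy0 Yx) (le_trans Yy0 (le_trans Yx xy)).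
    move=> /(_ isT isT xy); rewrite ler_pdivrMr // mulrAC ler_pdivlMr //.
    by rewrite mulrC [leRHS]mulrC.
  have sT : c / ln w * ln y <= b.
    have : ln y <= (1 + b) / 2 * ln w.
      have -> : (1 + b) / 2 = 1 + (b - 1) / 2 by field.
      by rewrite -ln_powR ler_ln // posrE powR_gt0.
    move=> Hy; apply: (@le_trans _ _ (c / ln w * ((1 + b) / 2 * ln w))).
      by rewrite ler_wpM2l // ltW.
    by rewrite -{2}cb le_eqVlt; apply/orP; left; apply/eqP; field; rewrite gt_eqF.
  have key : ln x `^ b * x `^ (- (c / ln w)) <= ln y `^ b * y `^ (- (c / ln w)).
    rewrite /powR !gt_eqF // -!expRD ler_expR.
    have XTp : 0 < ln x / ln y by rewrite divr_gt0.
    have : ln (ln x / ln y) <= ln x / ln y - 1.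
      have := @le_ln1Dx _ (ln x / ln y - 1).
      by rewrite [1 + _]addrC subrK; apply; lra.
    rewrite ln_div ?posrE //.
    move=> Hln; have : b * (ln (ln x) - ln (ln y)) <= b * (ln x / ln y - 1).
      by rewrite ler_pM2l.
    have : b * (ln x / ln y - 1) <= c / ln w * (ln x - ln y).
      have -> : b * (ln x / ln y - 1) = b / ln y * (ln x - ln y).
        by field; rewrite gt_eqF.
      rewrite ler_wnM2r ?subr_le0 //.
      by rewrite ler_pdivlMr.
    lra.
  have P0 : 0 < ln y `^ b by rewrite powR_gt0.
  rewrite -(ler_pM2r P0).
  apply: (@le_trans _ _ (L y * (ln x `^ b * x `^ (- (c / ln w))))).
    rewrite mulrAC [leRHS]mulrA; apply: ler_wpM2r => //; exact: powR_ge0.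
  rewrite [leRHS](_ : _ = L y * (ln y `^ b * y `^ (- (c / ln w)))); last by ring.
  by apply: ler_wpM2l => //; exact: ltW.
- rewrite ler_wpM2l ?(ltW (LY Y _)) // ler_powR ?(ltW Y1) //.
  by rewrite lerN2.
Unshelve. all: by end_near. Qed.

End deficit.

(** * The additional shrinkage *)

(** The square makes the positive part continuously differentiable, as Stein's
    identity requires. *)
Definition sqpos (R : realType) (x : R) : R := Num.max 0 x ^+ 2.

Lemma sqpos_taylor (R : realType) (x h : R) :
  `|sqpos (h + x) - sqpos x - 2 * Num.max 0 x * h| <= h ^+ 2.
Proof.
rewrite /sqpos !maxEle.
have [x0|x0] := leP 0 x; have [xh0|xh0] := leP 0 (h + x);
  rewrite ler_norml; apply/andP; split; nra.
Qed.

Lemma is_derive_sqpos (R : realType) (x : R) :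
  is_derive x 1 (@sqpos R) (2 * Num.max 0 x).
Proof.
have H : h^-1 *: (sqpos (h *: 1 + x) - sqpos x) @[h --> 0^'] --> 2 * Num.max 0 x.
  apply/cvgrPdist_le => e e0; near=> h.
  have h0 : h != 0 by near: h; exact: nbhs_dnbhs_neq.
  have he : `|h| <= e.
    by near: h; exact: dnbhs0_le.
  rewrite /GRing.scale /= mulr1 distrC.
  have -> : h^-1 * (sqpos (h + x) - sqpos x) - 2 * Num.max 0 x =
      (sqpos (h + x) - sqpos x - 2 * Num.max 0 x * h) / h by field.
  rewrite normrM normfV ler_pdivrMr ?normr_gt0 //.
  apply: (le_trans (sqpos_taylor x h)).
  by rewrite -real_normK ?num_real // expr2 ler_wpM2r.
split; first by apply/cvg_ex; eexists; exact: H.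
exact: cvg_lim H.
Unshelve. all: by end_near. Qed.

Lemma is_derive_inv (R : realType) (f : R -> R) (x df : R) : f x != 0 ->
  is_derive x 1 f df -> is_derive x 1 (fun y => (f y)^-1) (- df / f x ^+ 2).
Proof.
move=> fx0 fdf; have := is_deriveV fx0 fdf.
rewrite /GRing.scale /= => /is_derive_eq; apply.
by rewrite mulrC mulrN mulNr.
Qed.

Section correction.
Context (R : realType) (c w0 : R).
Hypothesis c0 : 0 < c.
Hypothesis w00 : 0 < w0.

Let T w : R := 1 + ln (1 + w).
Let v w : R := 1 - (1 + w0) / (1 + w).

(** It vanishes up to [w0], and [w * extra w] behaves like [c / ln w] at
    infinity. Since [v] increases to 1, the numerator only raises the derivative,
    which is favourable; the shifts by 1 keep the denominator positive. *)
Definition extra (w : R) : R := c * (sqpos (v w) / ((1 + w) * T w)).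

Definition dextra (w : R) : R :=
  c * (2 * Num.max 0 (v w) * ((1 + w0) / (1 + w) ^+ 2) / ((1 + w) * T w)
       - sqpos (v w) / ((1 + w) ^+ 2 * T w) * (1 + (T w)^-1)).

Let T1 (w : R) : 0 <= w -> 1 <= T w.
Proof. by move=> w_ge0; rewrite /T lerDl ln_ge0 // lerDl. Qed.

Lemma is_derive_extra (w : R) : 0 <= w -> is_derive w 1 extra (dextra w).
Proof.
move=> w_ge0; have s0 : 0 < 1 + w by lra.
have T0 : 0 < T w by exact: lt_le_trans (T1 w_ge0).
have sN : 1 + w != 0 by rewrite gt_eqF.
have TN : T w != 0 by rewrite gt_eqF.
have sTN : (1 + w) * T w != 0 by rewrite mulf_neq0.
have dl : is_derive w 1 (fun w => ln (1 + w)) ((1 + w)^-1 * 1).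
  apply: (@is_derive1_comp _ (@ln R) (fun w => 1 + w)).
    exact: is_derive1_ln.
  by apply: is_derive_eq; rewrite /GRing.scale /=; ring.
have dT : is_derive w 1 T (1 + w)^-1.
  by rewrite /T; apply: is_derive_eq; rewrite /GRing.scale /=; ring.
have dV : is_derive w 1 (fun w => (1 + w)^-1) (- ((1 + w) ^- 2)).
  have d1 : is_derive w 1 (fun w => 1 + w) 1.
    by apply: is_derive_eq; rewrite /GRing.scale /=; ring.
  by have := @is_derive_inv R (fun w => 1 + w) w _ sN d1; rewrite mulN1r.
have dv : is_derive w 1 v ((1 + w0) / (1 + w) ^+ 2).
  rewrite /v; apply: is_derive_eq; rewrite /GRing.scale /=; ring.
have ds : is_derive w 1 (fun w => sqpos (v w))
    (2 * Num.max 0 (v w) * ((1 + w0) / (1 + w) ^+ 2)).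
  apply: (@is_derive1_comp _ (@sqpos R) v); exact: is_derive_sqpos.
have dsT : is_derive w 1 (fun w => ((1 + w) * T w)^-1)
    (- ((1 + w) ^+ 2 * T w)^-1 * (1 + (T w)^-1)).
  have d1 : is_derive w 1 (fun w => (1 + w) * T w) (T w + 1).
    by apply: is_derive_eq; rewrite /GRing.scale /=; field.
  have := @is_derive_inv R (fun w => (1 + w) * T w) w _ sTN d1; congr (is_derive _ _ _ _).
  by field; rewrite sN TN.
rewrite /extra /dextra; apply: is_derive_eq; rewrite /GRing.scale /=.
by field; rewrite sN TN.
Qed.

Let max_v (w : R) : 0 <= w -> 0 <= Num.max 0 (v w) <= 1.
Proof.
move=> w_ge0; rewrite le_max lexx ge_max ler01 /= /v lerBlDr lerDl.
by rewrite divr_ge0 // addr_ge0 // ltW.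
Qed.

Lemma extra_bounds (w : R) : 0 <= w -> 0 <= extra w /\ extra w * (1 + w) <= c / T w.
Proof.
move=> w_ge0; have s0 : 0 < 1 + w by lra.
have T0 : 0 < T w by exact: lt_le_trans (T1 w_ge0).
have /andP[m0 m1] := max_v w_ge0.
rewrite /extra /sqpos; split.
  by rewrite mulr_ge0 ?(ltW c0) // divr_ge0 ?sqr_ge0 // mulr_ge0 // ltW.
have -> : c * (Num.max 0 (v w) ^+ 2 / ((1 + w) * T w)) * (1 + w) =
    c / T w * Num.max 0 (v w) ^+ 2 by field; rewrite !gt_eqF.
by rewrite ler_piMr ?exprn_ile1 // divr_ge0 // ltW.
Qed.

Lemma extra_le w : 0 <= w -> extra w * (1 + w) <= c.
Proof.
move=> w_ge0; have [_ H] := extra_bounds w_ge0; apply: (le_trans H).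
have T1w := T1 w_ge0; rewrite ler_pdivrMr; last exact: lt_le_trans T1w.
by rewrite ler_peMr // ltW.
Qed.

Lemma dextra_bound (w : R) : 0 <= w -> `|dextra w| * (1 + w) ^+ 2 <= 4 * c.
Proof.
move=> w_ge0; have s0 : 0 < 1 + w by lra.
have T0 : 0 < T w by exact: lt_le_trans (T1 w_ge0).
have TV1 : (T w)^-1 <= 1 by rewrite invf_le1 // T1.
have TV0 : 0 < (T w)^-1 by rewrite invr_gt0.
have /andP[m0 m1] := max_v w_ge0.
have q1 : 0 <= Num.max 0 (v w) * ((1 + w0) / (1 + w)) <= 1.
  have w010 : 0 <= (1 + w0) / (1 + w) by rewrite divr_ge0 // addr_ge0 // ltW.
  rewrite mulr_ge0 //=.
  have [v0|v0] := leP (v w) 0; first by rewrite mul0r.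
  rewrite mulr_ile1 //; first exact: ltW.
    by rewrite /v lerBlDr lerDl.
  by move: v0; rewrite /v subr_gt0 => /ltW.
rewrite -[X in _ * X](ger0_norm (sqr_ge0 _)) -normrM.
have -> : dextra w * (1 + w) ^+ 2 = c * (2 * (Num.max 0 (v w) * ((1 + w0) / (1 + w))) *
     (T w)^-1 - sqpos (v w) * (T w)^-1 * (1 + (T w)^-1)).
  by rewrite /dextra; field; rewrite !gt_eqF.
have m2 : 0 <= sqpos (v w) <= 1 by rewrite /sqpos sqr_ge0 expr_le1.
move: q1 m2 TV0 TV1; set q := _ * (_ / _); set s := sqpos _; set t := (T w)^-1.
move=> /andP[q0 q1] /andP[s00 s1] t0 t1.
rewrite normrM (gtr0_norm c0) mulrC ler_pM2r // ler_norml.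
have p1 (x y : R) : 0 <= x <= 1 -> 0 <= y <= 1 -> 0 <= x * y <= 1.
  by move=> /andP[? ?] /andP[? ?]; rewrite mulr_ge0 // mulr_ile1.
have t01 : 0 <= t <= 1 by rewrite (ltW t0).
have qt : 0 <= q * t <= 1 by apply: p1 => //; rewrite q0.
have st : 0 <= s * t <= 1 by apply: p1 => //; rewrite s00.
have stt := p1 _ _ st t01.
case/andP: qt => ? ?; case/andP: st => ? ?; case/andP: stt => ? ?.
by apply/andP; split; lra.
Qed.

Let T_gt0 (w : R) : 0 <= w -> 0 < T w.
Proof. by move=> w_ge0; exact: lt_le_trans (T1 w_ge0). Qed.

Lemma extra_eq0 (w : R) : 0 <= w <= w0 -> extra w = 0 /\ dextra w = 0.
Proof.
move=> /andP[w_ge0 ww0]; have s0 : 0 < 1 + w by lra.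
have v0 : v w <= 0 by rewrite /v subr_le0 ler_pdivlMr // mul1r lerD2l.
rewrite /extra /dextra /sqpos (max_l v0) expr0n /= !mul0r mulr0; split => //.
by rewrite !(mulr0, mul0r) subr0 mulr0.
Qed.

Lemma extra_gt0 (w : R) : w0 < w -> 0 < extra w.
Proof.
move=> ww0; have w_ge0 : 0 <= w by rewrite (le_trans (ltW w00)) // ltW.
have s0 : 0 < 1 + w by lra.
have v0 : 0 < v w by rewrite /v subr_gt0 ltr_pdivrMr // mul1r ltrD2l.
rewrite /extra /sqpos (max_r (ltW v0)) mulr_gt0 // divr_gt0 ?exprn_gt0 //.
by rewrite mulr_gt0 // T_gt0.
Qed.

(** With [u = extra w] and [t = (1 + ln (1 + w))^-1], the three contributions
    are [w * u ^+ 2 <= c * t * u], the deficit [- 4 * bp * u / ln w], and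
    [4 * u * t] from [- w * u' <= u * (1 + t)] once its leading term has
    cancelled. As [t <= (ln w)^-1], the total is at most
    [(c + 4 - 4 * bp) * u * t = - c * u * t]. *)
Lemma extra_gain (bp P x w : R) : c = 2 * (bp - 1) -> 1 < w -> w0 < w ->
  x <= P - 2 - 2 * bp / ln w ->
  w * extra w ^+ 2 + 2 * extra w * x - 2 * (P * extra w + 2 * w * dextra w) < 0.
Proof.
have c_gt0 : 0 < c := c0.
move=> cE w1 ww0 xP; have w_ge0 : 0 <= w by lra. have s0 : 0 < 1 + w by lra.
have T0 := T_gt0 w_ge0.
have v0 : 0 < v w by rewrite /v subr_gt0 ltr_pdivrMr // mul1r ltrD2l.
have u0 := extra_gt0 ww0; have [_ uc] := extra_bounds w_ge0.
set u := extra w in u0 uc *; set t := (T w)^-1.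
have t0 : 0 < t by rewrite invr_gt0.
have wu : w * u <= c * t.
  apply: le_trans uc; rewrite mulrC ler_pM2l //; lra.
have lnw0 : 0 < ln w by rewrite ln_gt0.
have lt : t <= (ln w)^-1.
  rewrite lef_pV2 ?posrE //; rewrite /T; have : ln w <= ln (1 + w) by rewrite ler_ln ?posrE //; lra.
  lra.
have dE : - (w * dextra w) <= u * (1 + t).
  have -> : dextra w = c * (2 * Num.max 0 (v w) * ((1 + w0) / (1 + w) ^+ 2) / ((1 + w) * T w))
      - u / (1 + w) * (1 + t).
    rewrite /dextra /u /extra /t; field; by rewrite !gt_eqF.
  have A0 : 0 <= w * (c * (2 * Num.max 0 (v w) * ((1 + w0) / (1 + w) ^+ 2) / ((1 + w) * T w))).
    rewrite mulr_ge0 // mulr_ge0 ?(ltW c0) // divr_ge0 //; last by rewrite mulr_ge0 // ltW.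
    rewrite mulr_ge0 //; first by rewrite mulr_ge0 // le_max lexx.
    by rewrite divr_ge0 ?sqr_ge0 // addr_ge0 // ltW.
  have A1 : w * (u / (1 + w) * (1 + t)) <= u * (1 + t).
    have -> : w * (u / (1 + w) * (1 + t)) = u * (1 + t) * (w / (1 + w)) by ring.
    rewrite ler_piMr //; first by rewrite mulr_ge0 ?(ltW u0) //; lra.
    by rewrite ler_pdivrMr // mul1r; lra.
  lra.
have lnu : u * t <= u * (ln w)^-1 by rewrite ler_pM2l.
have bp1 : 1 < bp by lra.
have bplnu : bp * (u * t) <= bp * (u * (ln w)^-1) by rewrite ler_pM2l //; lra.
have ux : u * x <= u * (P - 2 - 2 * bp / ln w) by rewrite ler_pM2l.
have uwu : u * (w * u) <= u * (c * t) by rewrite ler_pM2l.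
have ut : 0 < u * t by exact: mulr_gt0.
have : w * u ^+ 2 + 2 * u * x - 2 * (P * u + 2 * w * dextra w) <=
   u * (c * t) + 2 * (u * (P - 2 - 2 * bp / ln w)) - 2 * P * u + 4 * (u * (1 + t)).
  lra.
move/le_lt_trans; apply.
have -> : u * (c * t) + 2 * (u * (P - 2 - 2 * bp / ln w)) - 2 * P * u + 4 * (u * (1 + t)) =
  (c + 4) * (u * t) - 4 * (bp * (u * (ln w)^-1)) by ring.
rewrite cE; nra.
Qed.

Let m1w : measurable_fun [set: R] (fun w : R => 1 + w).
Proof. exact: measurable_funD. Qed.

Let mT : measurable_fun [set: R] T.
Proof.
by apply: measurable_funD => //; exact: (measurableT_comp (@measurable_ln R) m1w).
Qed.

Let mi (f : R -> R) : measurable_fun [set: R] f ->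
  measurable_fun [set: R] (fun w => (f w)^-1).
Proof. exact: (measurableT_comp (@measurable_inv R)). Qed.

Let mm : measurable_fun [set: R] (fun w => Num.max 0 (v w)).
Proof.
apply: measurable_maxr => //; apply: measurable_funB => //.
by apply: measurable_funM => //; exact: mi.
Qed.

Lemma measurable_extra : measurable_fun [set: R] extra.
Proof.
apply: measurable_funM => //; apply: measurable_funM; first exact: measurable_funX.
by apply: mi; exact: measurable_funM.
Qed.

Lemma measurable_dextra : measurable_fun [set: R] dextra.
Proof.
have m1w2 : measurable_fun [set: R] (fun w : R => (1 + w) ^+ 2).
  exact: measurable_funX.
apply: measurable_funM => //; apply: measurable_funB.
  apply: measurable_funM; last by apply: mi; exact: measurable_funM.
  apply: measurable_funM; first exact: measurable_funM.
  by apply: measurable_funM => //; exact: mi.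
apply: measurable_funM; last by apply: measurable_funD => //; exact: mi.
apply: measurable_funM; first exact: measurable_funX.
by apply: mi; exact: measurable_funM.
Qed.

Lemma continuous_dextra (w : R) : 0 <= w -> {for w, continuous dextra}.
Proof.
move=> w_ge0; have s0 : 0 < 1 + w by lra.
have T0 := T_gt0 w_ge0.
have c1w : {for w, continuous (fun w : R => 1 + w)}.
  by apply: cvgD; [exact: cvg_cst|exact: cvg_id].
have cT : {for w, continuous T}.
  apply: cvgD; first exact: cvg_cst.
  exact: (continuous_comp c1w (continuous_ln s0)).
have cV : {for w, continuous (fun w : R => (1 + w)^-1)}.
  by apply: cvgV => //; rewrite gt_eqF.
have cv : {for w, continuous v}.
  by apply: cvgB; [exact: cvg_cst|apply: cvgM; [exact: cvg_cst|exact: cV]].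
have cm : {for w, continuous (fun w => Num.max 0 (v w))}.
  by apply: continuous_max => //; exact: cvg_cst.
have cs : {for w, continuous (fun w => sqpos (v w))}.
  exact: (cvgM cm cm).
have c2 : {for w, continuous (fun w : R => (1 + w) ^+ 2)}.
  exact: (cvgM c1w c1w).
have cTV : {for w, continuous (fun w => (T w)^-1)}.
  by apply: cvgV => //; rewrite gt_eqF.
apply: cvgM; first exact: cvg_cst.
apply: cvgB.
  apply: cvgM.
    apply: cvgM; first by apply: cvgM; [exact: cvg_cst|exact: cm].
    apply: cvgM; first exact: cvg_cst.
    by apply: cvgV => //; rewrite gt_eqF // exprn_gt0.
  by apply: cvgV; [rewrite gt_eqF // mulr_gt0|exact: cvgM].
apply: cvgM; last by apply: cvgD; [exact: cvg_cst|exact: cTV].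
apply: cvgM; first exact: cs.
by apply: cvgV; [rewrite gt_eqF // mulr_gt0 // exprn_gt0|exact: cvgM].
Qed.

End correction.

(** * Stein's identity and integrability of the loss *)

Definition shrink (R : realType) (p : nat) (k : R -> R) (z : vec R p) : vec R p :=
  [tuple (1 - k (sqnorm z)) * tnth z i | i < p].

Lemma measurable_shrink (R : realType) (p : nat) (k : R -> R) :
  measurable_fun [set: R] k -> measurable_fun [set: vec R p] (@shrink R p k).
Proof.
move=> mk; apply/measurable_fun_tnthP => i.
rewrite (_ : _ \o _ = fun z : vec R p => (1 - k (sqnorm z)) * tnth z i); last first.
  by apply/funext => z; rewrite /= tnth_mktuple.
apply: measurable_funM; last exact: measurable_tnth.
apply: measurable_funB => //; apply: (measurableT_comp mk); exact: measurable_sqnorm.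
Qed.

Section risk.
Context (R : realType) (p : nat) (mu : vec R p).

Definition dens_const : R := (2 * pi) `^ (- (p%:R / 2)).

Lemma dens_const_gt0 : 0 < dens_const.
Proof. by rewrite powR_gt0 // mulr_gt0 // pi_gt0. Qed.

(** Gaussian of twice the variance, which absorbs polynomial factors. *)
Definition wide (z : vec R p) : R := \prod_(i < p) gauss1 (tnth mu i) 2 (tnth z i).

Lemma wide_expR z : wide z = expR (- (sqnorm (vsub z mu) / 4)).
Proof.
rewrite /wide /gauss1 -expR_sum sumrN sqnorm_vsub mulr_suml; congr (expR (- _)).
by apply: eq_bigr => i _; congr (_ / _); ring.
Qed.

Lemma density_prod z : std_normal_density mu z =
  dens_const * \prod_(i < p) gauss1 (tnth mu i) 1 (tnth z i).
Proof.
rewrite /std_normal_density /gauss1 -expR_sum sumrN sqnorm_vsub mulr_suml.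
by congr (_ * expR (- _)); apply: eq_bigr => i _; rewrite mulr1.
Qed.

Lemma density_le_wide z :
  (1 + sqnorm (vsub z mu)) * std_normal_density mu z <= 5 * dens_const * wide z.
Proof.
have S0 := sqnorm_ge0 (vsub z mu).
rewrite wide_expR /std_normal_density -/dens_const; set y := sqnorm _ / 4.
have y0 : 0 <= y by rewrite divr_ge0.
have -> : sqnorm (vsub z mu) / 2 = y + y by rewrite /y; field.
have -> : sqnorm (vsub z mu) = 4 * y by rewrite /y; field.
rewrite opprD expRD.
have -> : (1 + 4 * y) * (dens_const * (expR (- y) * expR (- y))) =
  dens_const * expR (- y) * ((1 + 4 * y) * expR (- y)) by ring.
rewrite [leRHS](_ : _ = dens_const * expR (- y) * 5); last by ring.
apply: ler_wpM2l.
  by rewrite mulr_ge0 ?expR_ge0 // ltW // dens_const_gt0.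
by rewrite expRN ler_pdivrMr ?expR_gt0 //; have := expR_ge1Dx y; lra.
Qed.

Lemma measurable_wide : measurable_fun [set: vec R p] wide.
Proof.
apply: (@measurable_prod_tnth R p (fun i => gauss1 (tnth mu i) 2)) => i.
exact: measurable_gauss1.
Qed.

Lemma wide_ge0 z : 0 <= wide z.
Proof. by rewrite wide_expR expR_ge0. Qed.

Lemma integrable_wide : (@lebesgue_vec R p).-integrable [set: vec R p] (EFin \o wide).
Proof.
apply/integrableP; split; first by apply/measurable_EFinP; exact: measurable_wide.
rewrite [ltLHS](_ : _ = (\int[@lebesgue_vec R p]_z (wide z)%:E)%E); last first.
  by apply: eq_integral => z _; rewrite /= ger0_norm // wide_ge0.
rewrite (@ge0_integral_vec_prod R p (fun i => gauss1 (tnth mu i) 2)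
  (fun=> Num.sqrt (2 * pi * 2))) ?ltry //.
- by move=> i; exact: measurable_gauss1.
- by move=> i x; exact: gauss1_ge0.
- by move=> i; exact: integral_gauss1.
Qed.

Lemma measurable_density : measurable_fun [set: vec R p] (std_normal_density mu).
Proof.
apply: measurable_funM => //; apply: (measurableT_comp (@measurable_expR R)).
apply: measurableT_comp => //; apply: measurable_funM => //.
under eq_fun do rewrite sqnorm_vsub.
apply: measurable_sum => i; apply: measurable_funX.
by apply: measurable_funB => //; exact: measurable_tnth.
Qed.

Lemma integrable_le_wide (f : vec R p -> R) (K : R) :
  measurable_fun [set: vec R p] f -> (forall z, `|f z| <= K * wide z) ->
  (@lebesgue_vec R p).-integrable [set: vec R p] (EFin \o f).
Proof.
move=> mf fK.
have iw : (@lebesgue_vec R p).-integrable [set: vec R p] (fun z => (K * wide z)%:E).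
  exact: (integrableZl measurableT K integrable_wide).
apply: (le_integrable _ _ _ iw) => //; first exact/measurable_EFinP.
by move=> z _; rewrite /= lee_fin (le_trans (fK z)) // ler_norm.
Qed.

Definition loss (k : R -> R) (z : vec R p) : R :=
  sqnorm (vsub (shrink k z) mu) * std_normal_density mu z.

Lemma loss_ge0 k z : 0 <= loss k z.
Proof. by rewrite mulr_ge0 ?sqnorm_ge0 ?std_normal_density_ge0. Qed.

Lemma integrable_loss (k : R -> R) (K : R) : measurable_fun [set: R] k ->
  (forall w, 0 <= w -> `|k w| <= K) ->
  (@lebesgue_vec R p).-integrable [set: vec R p] (EFin \o loss k).
Proof.
move=> mk kK; have K0 : 0 <= K by exact: le_trans (kK 0 (lexx _)).
apply: (@integrable_le_wide _
  ((2 * (1 + K) ^+ 2 + 2 * K ^+ 2 * sqnorm mu) * (5 * dens_const))).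
  apply: measurable_funM; last exact: measurable_density.
  under eq_fun do rewrite sqnorm_vsub.
  apply: measurable_sum => i; apply: measurable_funX.
  apply: measurable_funB => //.
  exact: (measurableT_comp (measurable_tnth i) (measurable_shrink mk)).
move=> z; rewrite ger0_norm ?loss_ge0 // -mulrA.
have S0 := sqnorm_ge0 (vsub z mu); have M0 := sqnorm_ge0 mu.
have {}kK := kK _ (sqnorm_ge0 z).
apply: (@le_trans _ _ ((2 * (1 + K) ^+ 2 + 2 * K ^+ 2 * sqnorm mu) *
    ((1 + sqnorm (vsub z mu)) * std_normal_density mu z))); last first.
  apply: ler_wpM2l; last exact: density_le_wide.
  by rewrite addr_ge0 // mulr_ge0 ?sqr_ge0 // mulr_ge0 ?sqr_ge0.
rewrite mulrA ler_wpM2r ?std_normal_density_ge0 //.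
set l := k (sqnorm z) in kK.
have l1K : (1 - l) ^+ 2 <= (1 + K) ^+ 2.
  by move: kK; rewrite ler_norml => /andP[? ?]; nra.
have lK : l ^+ 2 <= K ^+ 2.
  by move: kK; rewrite ler_norml => /andP[? ?]; nra.
apply: (@le_trans _ _ (2 * (1 - l) ^+ 2 * sqnorm (vsub z mu) + 2 * l ^+ 2 * sqnorm mu)).
  rewrite !sqnorm_vsub /sqnorm !mulr_sumr -big_split /=; apply: ler_sum => i _.
  rewrite tnth_mktuple -/l.
  have := sqr_ge0 ((1 - l) * (tnth z i - tnth mu i) + l * tnth mu i); nra.
have l0 := sqr_ge0 l.
apply: (@le_trans _ _ (2 * (1 + K) ^+ 2 * sqnorm (vsub z mu) + 2 * K ^+ 2 * sqnorm mu)).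
  by apply: lerD; apply: ler_wpM2r => //; rewrite ler_pM2l.
have K20 := sqr_ge0 K; have K10 := sqr_ge0 (1 + K).
have : 0 <= K ^+ 2 * sqnorm mu * sqnorm (vsub z mu) by rewrite !mulr_ge0.
nra.
Qed.

Section stein.
Context (c w0 : R).
Hypothesis c0 : 0 < c.
Hypothesis w00 : 0 < w0.

Let u := extra c w0.
Let du := dextra c w0.

(** Coordinate [i] of the integrand of Stein's identity for the correction
    [z |-> u (sqnorm z) z]. *)
Definition stein_term (i : 'I_p) (z : vec R p) : R :=
  ((tnth z i - tnth mu i) * (tnth z i * u (sqnorm z))
   - (u (sqnorm z) + 2 * tnth z i ^+ 2 * du (sqnorm z))) * std_normal_density mu z.

Let x_u_le (x r : R) : 0 <= r -> `|x * u (x ^+ 2 + r)| <= c.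
Proof.
move=> r0; have w_ge0 : 0 <= x ^+ 2 + r by rewrite addr_ge0 ?sqr_ge0.
have u_ge0 : 0 <= u (x ^+ 2 + r) by have [] := extra_bounds c0 w00 w_ge0.
apply: le_trans (extra_le c0 w00 w_ge0).
rewrite normrM (ger0_norm u_ge0) mulrC ler_wpM2l //.
have := sqr_ge0 (`|x| - 1); rewrite -(real_normK (num_real x)).
have := normr_ge0 x; nra.
Qed.

Let u_du_le (x r : R) : 0 <= r ->
  `|u (x ^+ 2 + r) + 2 * x ^+ 2 * du (x ^+ 2 + r)| <= 9 * c.
Proof.
move=> r0; have x20 := sqr_ge0 x.
have w_ge0 : 0 <= x ^+ 2 + r by rewrite addr_ge0.
have u_ge0 : 0 <= u (x ^+ 2 + r) by have [] := extra_bounds c0 w00 w_ge0.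
have ule : u (x ^+ 2 + r) * _ <= c := extra_le c0 w00 w_ge0.
have dle : `|du (x ^+ 2 + r)| * _ <= 4 * c := dextra_bound c0 w00 w_ge0.
rewrite (le_trans (ler_normD _ _)) // (ger0_norm u_ge0) (normrM (2 * x ^+ 2)).
have x220 : 0 <= 2 * x ^+ 2 by lra.
rewrite (ger0_norm x220).
move: dle; set D := `|du _|; set U := u _ in u_ge0 ule *.
have D0 : 0 <= D by exact: normr_ge0.
set w := x ^+ 2 + r in w_ge0 ule * => dle.
have U1 : U <= c.
  by apply: le_trans ule; rewrite ler_peMr // lerDl.
have D1 : x ^+ 2 * D <= 4 * c.
  apply: le_trans dle; rewrite mulrC ler_wpM2l //.
  have xw : x ^+ 2 <= w by rewrite lerDl.
  nra.
lra.
Qed.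

Let stein_bound (i : 'I_p) z :
  `|stein_term i z| <= 18 * c * (5 * dens_const) * wide z.
Proof.
have d0 := std_normal_density_ge0 mu z.
rewrite /stein_term normrM (ger0_norm d0).
rewrite [leRHS](_ : _ = 18 * c * (5 * dens_const * wide z)); last by ring.
have S0 := sqnorm_ge0 (vsub z mu).
apply: (@le_trans _ _ (18 * c * ((1 + sqnorm (vsub z mu)) * std_normal_density mu z)));
  last by apply: ler_wpM2l; [rewrite mulr_ge0 // ltW|exact: density_le_wide].
rewrite [leRHS]mulrA; apply: ler_wpM2r => //.
pose r := \sum_(j < p | j != i) tnth z j ^+ 2.
have r0 : 0 <= r by apply: sumr_ge0 => j _; rewrite sqr_ge0.
have zE : sqnorm z = tnth z i ^+ 2 + r by rewrite /sqnorm (bigD1 i).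
have := x_u_le (tnth z i) r0; have := u_du_le (tnth z i) r0; rewrite -zE => A B.
rewrite (le_trans (ler_normB _ _)) // (normrM (tnth z i - tnth mu i)).
have S1 : (tnth z i - tnth mu i) ^+ 2 <= sqnorm (vsub z mu).
  rewrite sqnorm_vsub (bigD1 i) //= lerDl.
  by apply: sumr_ge0 => j _; rewrite sqr_ge0.
have t1 : `|tnth z i - tnth mu i| <= 1 + sqnorm (vsub z mu).
  move: S1; rewrite -(real_normK (num_real (_ - _))); set t := `|_|.
  have := sqr_ge0 (t - 1); have : 0 <= t by exact: normr_ge0.
  nra.
apply: (@le_trans _ _ ((1 + sqnorm (vsub z mu)) * c + 9 * c)).
  by apply: lerD => //; apply: ler_pM.
have := ltW c0; nra.
Qed.

Lemma measurable_stein_term i : measurable_fun [set: vec R p] (stein_term i).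
Proof.
have mz : measurable_fun [set: vec R p] (fun z : vec R p => tnth z i : R).
  exact: measurable_tnth.
have mU : measurable_fun [set: vec R p] (fun z => u (sqnorm z)).
  exact: (measurableT_comp (measurable_extra c w0) (@measurable_sqnorm R p)).
have mD : measurable_fun [set: vec R p] (fun z => du (sqnorm z)).
  exact: (measurableT_comp (measurable_dextra c w0) (@measurable_sqnorm R p)).
apply: measurable_funM; last exact: measurable_density.
apply: measurable_funB.
  by apply: measurable_funM; [exact: measurable_funB|exact: measurable_funM].
apply: measurable_funD => //; apply: measurable_funM => //.
by apply: measurable_funM => //; exact: measurable_funX.
Qed.

Lemma integrable_stein_term i :
  (@lebesgue_vec R p).-integrable [set: vec R p] (EFin \o stein_term i).
Proof.
apply: (integrable_le_wide (measurable_stein_term i)) => z; exact: stein_bound.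
Qed.

Lemma integral_stein_term i :
  (\int[@lebesgue_vec R p]_z (stein_term i z)%:E = 0)%E.
Proof.
pose K := 18 * c * (5 * dens_const).
have C0 := dens_const_gt0.
have K0 : 0 <= K by rewrite !mulr_ge0 // ltW.
pose g j x := gauss1 (tnth mu j) 2 x.
pose s := Num.sqrt (2 * pi * 2) : R.
apply: (@integral_vec_section0 R p i _ (fun j x => if j == i then K * g j x else g j x)
  (fun j => if j == i then K * s else s)).
- exact: measurable_stein_term.
- move=> j; case: (j == i); last exact: measurable_gauss1.
  by apply: measurable_funM => //; exact: measurable_gauss1.
- move=> j x; case: ifP => _; last exact: gauss1_ge0.
  by apply: mulr_ge0 => //; exact: gauss1_ge0.
- move=> j; case: (j == i); last exact: integral_gauss1.
  under eq_integral do rewrite EFinM.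
  rewrite ge0_integralZl_EFin //.
  + by rewrite integral_gauss1 // -EFinM.
  + by move=> x _; rewrite lee_fin gauss1_ge0.
  + by apply/measurable_EFinP; exact: measurable_gauss1.
- move=> z; apply: (le_trans (stein_bound i z)).
  rewrite /wide (bigD1 i) //= [leRHS](bigD1 i) //= eqxx -[leRHS]mulrA.
  by rewrite [X in _ <= _ * (_ * X)](eq_bigr (fun j => g j (tnth z j))) // => j /negbTE ->.
move=> z; pose r := \sum_(j < p | j != i) tnth z j ^+ 2.
have r0 : 0 <= r by apply: sumr_ge0 => j _; rewrite sqr_ge0.
have wE x : sqnorm (vset z i x) = x ^+ 2 + r.
  rewrite /sqnorm (bigD1 i) //= tnth_mktuple eqxx; congr (_ + _).
  by apply: eq_bigr => j /negbTE ji; rewrite tnth_mktuple ji.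
pose G := dens_const * \prod_(j < p | j != i) gauss1 (tnth mu j) 1 (tnth z j).
have dE x : std_normal_density mu (vset z i x) = G * gauss1 (tnth mu i) 1 x.
  rewrite density_prod (bigD1 i) //= tnth_mktuple eqxx /G.
  rewrite -[RHS]mulrA [X in _ = _ * X]mulrC; congr (_ * (_ * _)).
  by apply: eq_bigr => j /negbTE ji; rewrite tnth_mktuple ji.
have G0 : 0 <= G.
  by rewrite mulr_ge0 ?(ltW C0) //; apply: prodr_ge0 => j _; exact: gauss1_ge0.
have w_ge0 (x : R) : 0 <= x ^+ 2 + r by rewrite addr_ge0 ?sqr_ge0.
have dU (x : R) : is_derive x 1 (fun x => u (x ^+ 2 + r)) (du (x ^+ 2 + r) * (2 * x)).
  apply: (@is_derive1_comp _ u (fun x => x ^+ 2 + r)).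
    exact: is_derive_extra.
  by apply: is_derive_eq; rewrite /GRing.scale /=; ring.
pose f x := G * (x * u (x ^+ 2 + r)).
pose f' x := G * (u (x ^+ 2 + r) + 2 * x ^+ 2 * du (x ^+ 2 + r)).
have -> : (fun x => (stein_term i (vset z i x))%:E) = (fun x =>
    (((x - tnth mu i) / 1 * f x - f' x) * gauss1 (tnth mu i) 1 x)%:E).
  apply/funext => x; rewrite /stein_term wE dE tnth_mktuple eqxx /f /f'.
  by congr EFin; field.
apply: (@stein1 R (tnth mu i) 1 (G * (9 * c)) f f') => //.
- move=> x; rewrite /f /f'.
  have := dU x => dUx; apply: is_derive_eq; rewrite /GRing.scale /=; ring.
- move=> x.
  have cw : {for x, continuous (fun x : R => x ^+ 2 + r)}.
    apply: cvgD; last exact: cvg_cst.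
    exact: sqr_continuous.
  have cU : {for x, continuous (fun x : R => u (x ^+ 2 + r))}.
    by apply/differentiable_continuous/derivable1_diffP; have [] := dU x.
  have cD : {for x, continuous (fun x : R => du (x ^+ 2 + r))}.
    exact: (continuous_comp cw (@continuous_dextra R c w0 _ (w_ge0 x))).
  apply: cvgM; first exact: cvg_cst.
  apply: cvgD; first exact: cU.
  apply: cvgM; last exact: cD.
  apply: cvgM; first exact: cvg_cst.
  exact: sqr_continuous.
- move=> x; rewrite normrM (ger0_norm G0) ler_wpM2l // (le_trans (x_u_le x r0)) //.
  by have := ltW c0; lra.
- by move=> x; rewrite normrM (ger0_norm G0) ler_wpM2l // u_du_le.
Qed.

End stein.

End risk.

(** * Domination *)

Lemma integral_gt0_support d (T : measurableType d) (R : realType)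
    (m : {measure set T -> \bar R}) (P X : T -> R) :
  measurable_fun [set: T] P -> measurable_fun [set: T] X ->
  (forall z, 0 <= X z) -> (forall z, P z != 0 -> 0 < X z) ->
  (\int[m]_z (P z)%:E != 0)%E -> (0 < \int[m]_z (X z)%:E)%E.
Proof.
move=> mP mX X0 PX IP.
rewrite lt_neqAle integral_ge0 ?andbT => [|z _]; last by rewrite lee_fin.
apply: contraNneq IP => IX.
have aeX : ae_eq m setT (EFin \o X) (cst 0%E).
  apply/ae_eq_integral_abs => //; first exact/measurable_EFinP.
  by rewrite [RHS]IX; apply: eq_integral => z _; rewrite /= ger0_norm.
apply/eqP; rewrite (ae_eq_integral (cst 0%E)) ?integral0 //.
  exact/measurable_EFinP.
apply: filterS aeX => z /= Xz0 _; congr EFin; apply/eqP/negPn/negP => /PX.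
by case: (Xz0 I) => ->; rewrite ltxx.
Qed.

Lemma integral_indic_itv_oo (R : realType) (x y : R) : x < y ->
  (\int[@lebesgue_measure R]_z (\1_`]x, y[ z : R)%:E = (y - x)%:E)%E.
Proof.
move=> xy; rewrite integral_indic //= setIT lebesgue_measure_itv /= lte_fin xy.
by rewrite -EFinB.
Qed.

(** A product of indicators of an interval beyond [w0 + 1] lives outside the
    ball and has integral 1. *)
Lemma integral_gt0_outside_ball (R : realType) (p : nat) (X : vec R p -> R) (w0 : R) :
  (0 < p)%N -> 0 <= w0 -> measurable_fun [set: vec R p] X ->
  (forall z, 0 <= X z) -> (forall z, w0 < sqnorm z -> 0 < X z) ->
  (0 < \int[@lebesgue_vec R p]_z (X z)%:E)%E.
Proof.
move=> p0 w00 mX X0 Xpos.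
pose K := w0 + 1.
pose b (x : R) : R := \1_(`]K, K + 1[%classic) x.
have mb : measurable_fun [set: R] b by exact: measurable_indic.
apply: (@integral_gt0_support _ _ _ _ (fun z : vec R p => \prod_(i < p) b (tnth z i))) => //.
- exact: (@measurable_prod_tnth R p (fun=> b)).
- move=> z Pz; apply: Xpos.
  have i0 : b (tnth z (Ordinal p0)) != 0.
    by apply: contraNN Pz => /eqP bz; rewrite (bigD1 (Ordinal p0)) //= bz mul0r.
  have zK : K < tnth z (Ordinal p0).
    move: i0; rewrite /b indicE mem_setE in_itv /=.
    by case: (ltP K (tnth z (Ordinal p0))) => //=; rewrite eqxx.
  rewrite /sqnorm (bigD1 (Ordinal p0)) //=.
  apply: (@lt_le_trans _ _ (tnth z (Ordinal p0) ^+ 2)).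
    by rewrite /K in zK; nra.
  by rewrite lerDl; apply: sumr_ge0 => j _; rewrite sqr_ge0.
- rewrite (@ge0_integral_vec_prod R p (fun=> b) (fun=> 1)) ?big1 ?onee_neq0 //.
  by move=> _; rewrite integral_indic_itv_oo ?ltrDl // addrAC subrr add0r.
Qed.

Section domination.
Context (R : realType) (p : nat) (k : R -> R) (c w0 : R).
Let u := extra c w0.
Let du := dextra c w0.
Let gain (w : R) := w * u w ^+ 2 + 2 * u w * (w * k w) - 2 * (p%:R * u w + 2 * w * du w).

(** Expanding the square leaves a cross term in [z - mu]; Stein's terms trade it
    for derivatives, and they integrate to zero. *)
Lemma loss_extra (mu z : vec R p) :
  loss mu k z = loss mu (fun w => k w + u w) z +
    (- gain (sqnorm z) * std_normal_density mu z +
     2 * \sum_(i < p) stein_term mu c w0 i z).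
Proof.
pose A := \sum_(i < p) tnth z i * (tnth z i - tnth mu i).
pose w := sqnorm z.
have E1 : sqnorm (vsub (shrink (fun w => k w + u w) z) mu) =
    sqnorm (vsub (shrink k z) mu) + w * u w ^+ 2 + 2 * u w * (w * k w) - 2 * u w * A.
  rewrite !sqnorm_vsub /w /sqnorm /A.
  rewrite [X in _ = _ + X - _](_ : _ = (2 * u (sqnorm z) * k (sqnorm z)) * sqnorm z); last first.
    by rewrite /sqnorm; ring.
  rewrite /sqnorm mulr_suml !mulr_sumr -sumrN -!big_split /=.
  apply: eq_bigr => i _; rewrite !tnth_mktuple -/(sqnorm z); ring.
have E2 : \sum_(i < p) stein_term mu c w0 i z =
    (u w * A - (p%:R * u w + 2 * w * du w)) * std_normal_density mu z.
  rewrite /stein_term -mulr_suml; congr (_ * _).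
  rewrite big_split /= sumrN big_split /= sumr_const card_ord.
  congr (_ - (_ + _)).
    by rewrite /A mulr_sumr; apply: eq_bigr => i _; rewrite -/u -/w; ring.
    by rewrite mulr_natl.
  by rewrite -mulr_suml -mulr_sumr.
by rewrite E2 /loss E1 /gain -/w; ring.
Qed.

Hypothesis c0 : 0 < c.
Hypothesis w00 : 0 < w0.
Hypothesis mk : measurable_fun [set: R] k.
Hypothesis k01 : forall w, 0 <= w -> 0 <= k w <= 1.
Hypothesis p0 : (0 < p)%N.
Hypothesis gain_lt0 : forall w, w0 < w -> gain w < 0.

Let gain_le0 w : 0 <= w -> gain w <= 0.
Proof.
move=> w_ge0; have [ww0|w0w] := leP w w0; last by rewrite ltW // gain_lt0.
have w0w : 0 <= w <= w0 by rewrite w_ge0.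
have [u0 du0] := extra_eq0 c w0w.
by rewrite /gain /u /du u0 du0; lra.
Qed.

Let mku : measurable_fun [set: R] (fun w => k w + u w).
Proof. by apply: measurable_funD => //; exact: measurable_extra. Qed.

(** All integrands are dominated by a Gaussian, hence the Stein terms may be
    separated and dropped, and the nonnegative remainder is positive on a set of
    positive measure. *)
Lemma risk_extra (mu : vec R p) :
  (risk (shrink (fun w => k w + u w)%R) mu < risk (shrink k) mu)%E.
Proof.
pose X z := - gain (sqnorm z) * std_normal_density mu z.
pose S z := \sum_(i < p) stein_term mu c w0 i z.
pose l1 := loss mu (fun w => k w + u w).
have i0 : (@lebesgue_vec R p).-integrable [set: vec R p] (EFin \o loss mu k).
  apply: (@integrable_loss R p mu k 1) => // w w_ge0.
  by have /andP[? ?] := k01 w_ge0; rewrite ger0_norm.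
have i1 : (@lebesgue_vec R p).-integrable [set: vec R p] (EFin \o l1).
  apply: (@integrable_loss R p mu _ (1 + c)) => // w w_ge0.
  have /andP[? ?] := k01 w_ge0.
  have [u_ge0 _] := extra_bounds c0 w00 w_ge0.
  have ule : u w <= c.
    by apply: le_trans (extra_le c0 w00 w_ge0); rewrite ler_peMr // lerDl.
  by rewrite ger0_norm ?addr_ge0 // lerD.
have SE : EFin \o S = fun z => (\sum_(i < p) (stein_term mu c w0 i z)%:E)%E.
  by apply/funext => z; rewrite /= sumEFin.
have iS0 : (@lebesgue_vec R p).-integrable [set: vec R p] (EFin \o S).
  by rewrite SE; apply: integrable_sum => // i _; exact: integrable_stein_term.
have iS : (@lebesgue_vec R p).-integrable [set: vec R p] (EFin \o (fun z => 2 * S z)).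
  exact: (integrableZl measurableT 2 iS0).
have IS : (\int[@lebesgue_vec R p]_z (2 * S z)%:E = 0)%E.
  under eq_integral do rewrite EFinM.
  rewrite integralZl // -[X in (_ * X)%E]/(\int[@lebesgue_vec R p]_z (EFin \o S) z)%E SE.
  rewrite integral_sum // => [|i]; last exact: integrable_stein_term.
  by rewrite big1 ?mule0 // => i _; exact: integral_stein_term.
have iX : (@lebesgue_vec R p).-integrable [set: vec R p] (EFin \o X).
  have := integrableB measurableT (integrableB measurableT i0 i1) iS.
  apply: eq_integrable => // z _ /=.
  by rewrite -!EFinB (loss_extra mu z) -/(l1 z) -/(S z) -/(X z); congr EFin; ring.
have X_ge0 z : 0 <= X z.
  by rewrite mulr_ge0 ?std_normal_density_ge0 // oppr_ge0 gain_le0 // sqnorm_ge0.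
have IX : (0 < \int[@lebesgue_vec R p]_z (X z)%:E)%E.
  apply: (@integral_gt0_outside_ball R p X w0) => //; first exact: ltW.
    by have := measurable_int _ iX => /measurable_EFinP.
  move=> z wz; rewrite mulr_gt0 // ?oppr_gt0 ?gain_lt0 //.
  by rewrite mulr_gt0 ?expR_gt0 // dens_const_gt0.
have -> : risk (shrink k) mu = (risk (shrink (fun w => k w + u w)%R) mu +
    \int[@lebesgue_vec R p]_z (X z)%:E)%E.
  rewrite -[X in (_ + X)%E]adde0 -IS -integralD_EFin // -integralD_EFin //; last first.
    exact: integrableD iX iS.
  by apply: eq_integral => z _; rewrite -!EFinD -loss_extra.
rewrite lteDl //; exact: (integrable_fin_num measurableT i1).
Qed.

End domination.

Lemma measurable_laplace (R : realType) (W : R -> R) :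
  measurable_fun [set: R] W -> (forall l, 0 <= W l) ->
  measurable_fun [set: R] (laplace W).
Proof.
move=> mW W0.
pose f (x : measurableTypeR R * measurableTypeR R) : \bar R :=
  (W x.2 * expR (- (x.2 * x.1 / 2)))%:E.
have := @measurable_fun_fubini_tonelli_F _ _ _ _ R (@lebesgue_measure R) f.
apply => [|x]; last by rewrite lee_fin mulr_ge0 ?expR_ge0.
apply/measurable_EFinP; apply: measurable_funM.
  by apply: (measurableT_comp mW); exact: measurable_snd.
apply: (measurableT_comp (@measurable_expR R)); apply: measurableT_comp => //.
by apply: measurable_funM => //; apply: measurable_funM.
Qed.

Lemma laplace_gt0 (R : realType) (W : R -> R) (e w : R) : 0 < e ->
  measurable_fun [set: R] W -> (forall l, 0 <= W l) ->
  (forall l, 0 < l < e -> 0 < W l) -> (0 < laplace W w)%E.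
Proof.
move=> e0 mW W0 We.
apply: (@integral_gt0_support _ _ R (@lebesgue_measure R) (\1_`]0, e[ : R -> R)
  (fun l => W l * expR (- (l * w / 2)))) => //.
- exact: measurable_laplace_integrand.
- by move=> l; rewrite mulr_ge0 ?expR_ge0.
- move=> l; rewrite indicE mem_setE in_itv /=; have [le _|_] := boolP (0 < l < e); last by rewrite eqxx.
  by rewrite mulr_gt0 ?expR_gt0 // We.
- by rewrite integral_indic_itv_oo // subr0 eqe gt_eqF.
Qed.

(** The radius [w0] is taken so large that the deficit inequality holds beyond
    it; [extra] vanishes before, where nothing is known about the quotient. *)
Lemma inadmissible_gen_bayes (R : realType) (p : nat) (a : R) (L : R -> R) :
  (0 < p)%N -> 0 < p%:R / 2 + a + 1 -> (forall y, 1 <= y -> 0 <= L y) ->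
  slowly_varying L -> differentiable_from 1 L ->
  ultimately_monotone L^`()%classic ->
  (exists bp, 1 < bp /\ \forall w \near +oo, forall J0 J1,
    laplace (mixing p a L) w = J0%:E ->
    laplace (fun l => l * mixing p a L l) w = J1%:E ->
    w * J1 <= (p%:R - 2 - 2 * bp / ln w) * J0) ->
  inadmissible (gen_bayes (@prior_density R p a L)).
Proof.
move=> p0 q0 L0 L1 L3 L'm [bp [bp1 [M [_ HM]]]].
set W := mixing p a L in HM.
have mW : measurable_fun [set: R] W by exact: measurable_mixing.
have W0 l : 0 <= W l by exact: mixing_ge0.
have Wout l : ~~ (0 < l < 1) -> W l = 0 by exact: mixing_out.
have mW1 : measurable_fun [set: R] (fun l => l * W l) by exact: measurable_funM.
have W10 l : 0 <= l * W l.
  have [/andP[l0 _]|l01] := boolP (0 < l < 1); first by rewrite mulr_ge0 // ltW.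
  by rewrite Wout // mulr0.
have q20 : 0 < (p%:R / 2 + a + 1) / 2 by rewrite divr_gt0.
have [C [_ HC]] := slowly_varying_le_powR L0 L1 L3 L'm q20.
have Woo w : 0 <= w -> (laplace W w < +oo)%E by exact: (laplace_mixing_lty q0 L0 L3 HC).
have Wpos w : (0 < laplace W w)%E.
  have [Y [_ HY]] := slowly_varying_gt0 L0 L1.
  pose e := (Num.max Y 1 + 1)^-1.
  have Y0 : 0 < Num.max Y 1 + 1.
    by rewrite (@lt_le_trans _ _ 1) // lerDr le_max ler01 orbT.
  apply: (@laplace_gt0 R W e) => //; first by rewrite invr_gt0.
  move=> l /andP[l0 le].
  have lV : Num.max Y 1 + 1 < l^-1.
    by rewrite -[ltLHS]invrK ltf_pV2 ?posrE ?invr_gt0.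
  have l1 : l < 1.
    apply: (lt_le_trans le); rewrite invf_le1 // lerDr le_max ler01 orbT //.
  rewrite /W /mixing l0 l1 /= mulr_gt0 ?powR_gt0 //; apply: HY.
  by apply: le_lt_trans lV; rewrite ler_wpDr // le_max lexx.
have W10' w : (0 <= laplace (fun l => (l * W l)%R) w)%E.
  by apply: integral_ge0 => l _; rewrite lee_fin mulr_ge0 ?expR_ge0.
pose J0 w := fine (laplace W w).
pose J1 w := fine (laplace (fun l => l * W l) w).
have J0E w : 0 <= w -> laplace W w = (J0 w)%:E.
  by move=> w0; rewrite fineK // ge0_fin_numE ?Woo // ltW.
have J1E w : 0 <= w -> laplace (fun l => l * W l) w = (J1 w)%:E.
  move=> w0; rewrite fineK // ge0_fin_numE //.
  by apply: le_lt_trans (Woo w w0); exact: le_laplace_id.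
have J0p w : 0 <= w -> 0 < J0 w by move=> w0; rewrite -lte_fin -J0E.
pose k w := J1 w / J0 w.
have mk : measurable_fun [set: R] k.
  apply: measurable_funM.
    by apply: measurableT_comp => //; exact: measurable_laplace.
  apply: (measurableT_comp (@measurable_inv R)).
  by apply: measurableT_comp => //; exact: measurable_laplace.
have k01 w : 0 <= w -> 0 <= k w <= 1.
  move=> w0; rewrite /k divr_ge0 ?(ltW (J0p w w0)) //=; last first.
    by rewrite -lee_fin -J1E.
  rewrite ler_pdivrMr ?J0p // mul1r -lee_fin -J0E // -J1E //.
  exact: le_laplace_id.
have -> : gen_bayes (@prior_density R p a L) = @shrink R p k.
  have -> : @prior_density R p a L = mixture_prior W.
    by apply/funext => m; exact: prior_density_mixture.
  apply/funext => z; apply: eq_from_tnth => i; rewrite [RHS]tnth_mktuple.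
  have z0 := sqnorm_ge0 z.
  apply: (gen_bayes_mixture mW W0 Wout i (J0E _ z0) _ (J1E _ z0)).
  by rewrite gt_eqF ?J0p.
pose w0 := Num.max M 1; pose c := 2 * (bp - 1).
have c0 : 0 < c by rewrite mulr_gt0 // subr_gt0.
have w00 : 0 < w0 by rewrite lt_max ltr01 orbT.
have lt mu := @risk_extra R p k c w0 c0 w00 mk k01 p0 _ mu.
have {}lt mu : (risk (shrink (fun w => k w + extra c w0 w)%R) mu <
    risk (@shrink R p k) mu)%E.
  apply: lt => w w0w; have w1 : 1 < w by apply: le_lt_trans w0w; rewrite le_max lexx orbT.
  have wM : M < w by apply: le_lt_trans w0w; rewrite le_max lexx.
  have w_ge0 : 0 <= w by lra.
  apply: (@extra_gain R c w0 c0 w00 bp) => //.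
  rewrite /k mulrA ler_pdivrMr ?J0p //.
  by apply: HM => //; [exact: J0E|exact: J1E].
exists (shrink (fun w => k w + extra c w0 w)); split.
- apply: measurable_shrink; apply: measurable_funD => //; exact: measurable_extra.
- by move=> mu; exact: ltW.
- by exists [tuple (0 : R) | i < p].
Qed.

Theorem theorem3p2 (R : realType) (p : nat) (a : R) (L : R -> R)
  (hp : (3 <= p)%N)
  (ha : 0 < p%:R / 2 + a + 1)
  (L_ge0 : forall y, 1 <= y -> 0 <= L y)
  (L1 : slowly_varying L)
  (L2 : ultimately_monotone L)
  (L3 : differentiable_from 1 L /\ ultimately_monotone L^`()%classic) :
  (a = - 2 ->
   (exists b : R, 1 < b /\
      ultimately_nonincreasing (fun y => ln y `^ b / L y)) ->
   inadmissible (gen_bayes (@prior_density R p a L))) /\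
  (a < - 2 ->
   inadmissible (gen_bayes (@prior_density R p a L))).
Proof.
have [dL dL'] := L3; have p0 : (0 < p)%N by exact: leq_trans hp.
split=> [a2 [b [b1 Lb]]|a2].
  apply: inadmissible_gen_bayes => //.
  exact: (mixing_deficit_log L_ge0 L1 dL dL' ha a2 b1 Lb).
apply: inadmissible_gen_bayes => //.
exact: (mixing_deficit_lt L_ge0 L1 dL dL' ha a2).
Qed.
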